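(* Let $\mathcal{M}=(M_2(\mathbb{C}),\frac12 Tr)*(M_2(\mathbb{C}),\frac12 Tr)$ with its faithful normal trace $\tau$, and let $\mathfrak{A}_4\subseteq\mathcal{B}(L^2(\mathcal{M},\tau))$ be the algebra generated by $E_{12}$, $F_{12}$ and $\mathcal{M}'$. Then $\mathfrak{A}_4$ is not a transitive algebra. Indeed, for any $0\leq r\leq 1$ there is a projection $F_r\in\mathcal{M}$ such that $\tau(F_r)=r$ and $F_r\in \mathrm{Lat}\,\mathfrak{A}_4$.
   Context: $\mathcal{M}$ is the reduced free product von Neumann algebra of two copies of $M_2(\mathbb{C})$ with respect to the normalized trace $\frac12 Tr$; it is a type $II_1$ factor with faithful normal trace $\tau$. $(E_{ij})_{i,j=1,2}$ and $(F_{ij})_{i,j=1,2}$ are the standard matrix units of the first copy $(M_2(\mathbb{C}),\frac12 Tr)*1$ and of the second copy $1*(M_2(\mathbb{C}),\frac12 Tr)$ inside $\mathcal{M}$, respectively. $\mathcal{M}$ acts on $L^2(\mathcal{M},\tau)$ by left multiplication and $\mathcal{M}'$ is its commutant. ''Algebra generated'' means the (not necessarily self-adjoint or closed) algebra generated. A subalgebra of $\mathcal{B}(\mathcal{H})$ is transitive if it contains the identity and has no invariant closed subspaces other than $\{0\}$ and $\mathcal{H}$. For a projection $P$ and a set $\mathfrak{A}$ of operators, $P\in\mathrm{Lat}\,\mathfrak{A}$ means the range of $P$ is invariant under every $T\in\mathfrak{A}$, i.e. $PTP=TP$ for all $T\in\mathfrak{A}$. *)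

(* Defs.v *)
From HB Require Import structures.
From mathcomp Require Import all_boot all_order all_algebra.
From mathcomp Require Import sesquilinear spectral complex.
From mathcomp Require Import boolp classical_sets functions reals topology normedtype.
Set Implicit Arguments.
Unset Strict Implicit.
Unset Printing Implicit Defensive.
Import Order.TTheory GRing.Theory Num.Theory Num.Def.
Import numFieldNormedType.Exports.
Local Open Scope classical_set_scope.
Local Open Scope ring_scope.
Local Open Scope sesquilinear_scope.
Local Open Scope complex_scope.

(* A complex Hilbert space is a complete normed module [H] over [R[i]] together
   with an inner product [ip], linear in its first argument, such that
   [is_hilbert ip]. Operators are plain maps [H -> H] and sets of operators have
   type [set (H -> H)]. *)
Section Operators.
Variables (R : realType) (H : completeNormedModType R[i]).
Variable ip : {dot H for @conjC R[i]}.
Implicit Types (S T P : H -> H) (A : set (H -> H)) (K : set H).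

Definition is_hilbert : Prop := forall x : H, ip x x = `|x| ^+ 2.

Definition bounded_ops : set (H -> H) := [set T | linear T /\ continuous T].

Definition adjoint T S : Prop := forall x y : H, ip (T x) y = ip x (S y).

Definition projection P : Prop :=
  [/\ bounded_ops P, P \o P = P & adjoint P P].

Definition subalgebra A : Prop :=
  [/\ A `<=` bounded_ops,
      A (fun=> 0),
      forall S T, A S -> A T -> A (fun x => S x + T x),
      forall (c : R[i]) T, A T -> A (fun x => c *: T x) &
      forall S T, A S -> A T -> A (S \o T)].

Definition algebra_generated A : set (H -> H) := smallest subalgebra A.

Definition closed_subspace K : Prop :=
  [/\ closed K, K 0 & forall (c : R[i]) x y, K x -> K y -> K (c *: x + y)].

Definition invariant K A : Prop := forall T, A T -> T @` K `<=` K.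

Definition transitive_algebra A : Prop :=
  [/\ subalgebra A, A id &
      forall K, closed_subspace K -> invariant K A ->
        K = [set 0] \/ K = setT].

Definition in_Lat P A : Prop :=
  projection P /\ forall T, A T -> P \o T \o P = T \o P.

Definition commutant A : set (H -> H) :=
  [set T | bounded_ops T /\ forall S, A S -> S \o T = T \o S].

Definition vN_generated A : set (H -> H) :=
  commutant (commutant (A `|` [set S | exists2 T, A T & adjoint T S])).

Definition vector_state (Omega : H) : (H -> H) -> R[i] :=
  fun T => ip (T Omega) Omega.

(* [(k_0, T_0), ..., (k_n, T_n)] ranges over the alternating words of centered
   elements of [A] ([k_j = false]) and [B] ([k_j = true]). *)
Definition free_pair (tau : (H -> H) -> R[i]) (A B : set (H -> H)) : Prop :=
  forall (n : nat) (k : nat -> bool) (T : nat -> H -> H),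
    (forall j, (j <= n)%N -> (if k j then B else A) (T j) /\ tau (T j) = 0) ->
    (forall j, (j < n)%N -> k j != k j.+1) ->
    tau (\big[(fun S S' => S \o S')/id]_(0 <= j < n.+1) T j) = 0.

(* [phi] embeds (M_2(C), Tr/2), as a unital *-algebra with trace, in B(H). *)
Definition matrix_copy (tau : (H -> H) -> R[i]) (phi : 'M[R[i]]_2 -> H -> H)
    : Prop :=
  [/\ forall a, bounded_ops (phi a),
      forall (c : R[i]) a b, phi (c *: a + b) = (fun x => c *: phi a x + phi b x),
      phi 1%:M = id /\ (forall a b, phi (a *m b) = phi a \o phi b),
      forall a, adjoint (phi a) (phi (a ^t*)) &
      forall a, tau (phi a) = 2^-1 * \tr a].

Definition vN_of_copies (phi psi : 'M[R[i]]_2 -> H -> H) : set (H -> H) :=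
  vN_generated (range phi `|` range psi).

(* The reduced free product (M, tau) = (M_2(C), Tr/2) * (M_2(C), Tr/2), acting
   by left multiplication on H = L^2(M, tau), with [phi], [psi] the two
   embeddings and [Omega] the vector 1 of L^2(M, tau): M is generated by free
   copies of the two factors, tau is a faithful trace on M, and Omega is a
   cyclic vector implementing tau (so tau is normal). These conditions determine
   (H, phi, psi, Omega) up to unitary equivalence. *)
Definition free_product_M2 (phi psi : 'M[R[i]]_2 -> H -> H) (Omega : H) : Prop :=
  let M := vN_of_copies phi psi in
  let tau := vector_state Omega in
  [/\ matrix_copy tau phi /\ matrix_copy tau psi,
      free_pair tau (range phi) (range psi),
      forall S T, M S -> M T -> tau (S \o T) = tau (T \o S),
      forall S T, M T -> adjoint T S -> tau (S \o T) = 0 -> T = (fun=> 0) &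
      closure [set T Omega | T in M] = setT].

(* [phi (delta_mx 0 1)] and [psi (delta_mx 0 1)] are the matrix units E_12 and
   F_12, since 'I_2 is numbered from 0. *)
Definition algebra_A4 (phi psi : 'M[R[i]]_2 -> H -> H) : set (H -> H) :=
  algebra_generated
    ([set phi (delta_mx 0 1); psi (delta_mx 0 1)]
       `|` commutant (vN_of_copies phi psi)).

End Operators.

(* Main.v *)
(** Write [a_0 = E_12], [a_1 = F_12].  For [0 < s < 1/2] let [k_n] be the sum of
    [s^-m w^* w] over the nonempty alternating words [w] of length [m <= n] in [a_0],
    [a_1].
    The space of the vectors [x] on which the forms [<k_n x, x>] stay bounded is
    invariant under [a_0], [a_1] and [M'], and the projection onto its closure is
    the strong limit of [(1 + c k_n)^-1], first for [n -> oo] and then for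
    [c -> 0].  Its trace is [s / (1 - s)], which takes every value in [(0, 1)].

    To see this, split [k_n] according to the last letter [a_i] of the words; the
    two parts are free, and with [h_n c] the trace of [(1 + c k_n,i)^-1] the
    recursion [k_(n+1),i = s^-1 a_i^* (1 + k_n,1-i) a_i] becomes, by freeness,
    [h_(n+1) c' = h_n c (1 - c)] for [c' = 2 s c h / (2 h (1 - c) - 1)], [h = h_n c].
    The resolvents involved are explicit Neumann series in alternating products of
    centered elements; they converge in norm because [h > 1/2].  Comparing with
    the fixed points [c = 0] of this planar map shows that [h_n c] tends to
    [1 / (2 (1 - s))], the value of [h] where the map has slope [1] at [c = 0]. *)
Require Import Defs.
From mathcomp Require Import all_boot all_order all_algebra.
From mathcomp Require Import sesquilinear complex ring lra.
From mathcomp Require Import boolp classical_sets functions reals topology normedtype.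
Set Implicit Arguments.
Unset Strict Implicit.
Unset Printing Implicit Defensive.
Import Order.TTheory GRing.Theory Num.Theory Num.Def.
Import numFieldNormedType.Exports.
Local Open Scope classical_set_scope.
Local Open Scope ring_scope.
Local Open Scope complex_scope.

(** * Complex Hilbert spaces as real inner product spaces *)

Section RealHilbert.
Variables (R : realType) (H : completeNormedModType R[i]).
Variable ip : {dot H for @conjC R[i]}.
Hypothesis hH : is_hilbert ip.
Implicit Types (x y z : H) (T S : H -> H) (a b c : R).

(** Taking real parts puts the scalar computations over [R], within reach of [lra] and [nra];
    [sym_adjoint] leads back to the complex inner product. *)
Definition rip x y : R := complex.Re (ip x y).
Definition nm x : R := complex.Re `|x|.

Lemma ripDl x y z : rip (x + y) z = rip x z + rip y z.
Proof. by rewrite /rip linearDl raddfD. Qed.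
Lemma ripDr x y z : rip z (x + y) = rip z x + rip z y.
Proof. by rewrite /rip linearDr raddfD. Qed.
Lemma ripZl c x z : rip (c%:C *: x) z = c * rip x z.
Proof. by rewrite /rip linearZl_LR /=; case: (ip x z) => u v /=; rewrite mul0r subr0. Qed.
Lemma conjCE (u : R[i]) : u^* = (u^*)%C.
Proof. by []. Qed.
Lemma ipC x y : ip x y = (ip y x)^*.
Proof. by rewrite [LHS]hermitian_subproof expr0 mul1r. Qed.
Lemma ripC x y : rip x y = rip y x.
Proof. by rewrite /rip ipC conjCE; case: (ip y x). Qed.
Lemma ripZr c x z : rip z (c%:C *: x) = c * rip z x.
Proof. by rewrite ripC ripZl ripC. Qed.
Lemma rip0l z : rip 0 z = 0.
Proof. by have := ripDl 0 0 z; rewrite addr0; lra. Qed.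
Lemma ripNl x z : rip (- x) z = - rip x z.
Proof. by have /eqP := ripDl x (- x) z; rewrite subrr rip0l eq_sym addrC addr_eq0 => /eqP. Qed.
Lemma ripNr x z : rip z (- x) = - rip z x.
Proof. by rewrite ripC ripNl ripC. Qed.
Lemma rip0r z : rip z 0 = 0.
Proof. by rewrite ripC rip0l. Qed.

Definition ripE := (ripDl, ripDr, ripZl, ripZr, ripNl, ripNr, rip0l, rip0r).

Lemma normE x : `|x| = (nm x)%:C.
Proof. by rewrite /nm RRe_real // ger0_real. Qed.
Lemma nm_ge0 x : 0 <= nm x.
Proof. by rewrite -ler0c -normE. Qed.
Lemma nmK x : nm x ^+ 2 = rip x x.
Proof.
apply: complexI; rewrite rmorphXn /= -normE -hH /rip RRe_real //.
by rewrite hH realX // ger0_real.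
Qed.
Lemma rip_ge0 x : 0 <= rip x x.
Proof. by rewrite -nmK sqr_ge0. Qed.
Lemma nmD x y : nm (x + y) <= nm x + nm y.
Proof. by rewrite -lecR rmorphD /= -!normE ler_normD. Qed.
Lemma nmN x : nm (- x) = nm x.
Proof. by rewrite /nm normrN. Qed.
Lemma nmB x y : nm (x - y) <= nm x + nm y.
Proof. by rewrite -(nmN y) nmD. Qed.
Lemma nm0 : nm 0 = 0.
Proof. by rewrite /nm normr0. Qed.
Lemma nmZ c x : nm (c%:C *: x) = `|c| * nm x.
Proof.
apply: complexI; rewrite -normE normrZ rmorphM /= -normE; congr (_ * _).
by rewrite normc_def /= expr0n addr0 sqrtr_sqr.
Qed.
Lemma nm0_eq0 x : nm x = 0 -> x = 0.
Proof. by move=> h; apply/normr0_eq0; rewrite normE h. Qed.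
Lemma rip0_eq0 x : rip x x = 0 -> x = 0.
Proof. by move=> h; apply: nm0_eq0; apply/eqP; rewrite -sqrf_eq0 nmK h. Qed.
(** Testing against an arbitrary [z] reduces an identity of vectors to a linear identity of reals;
    the resolvent formulas below are verified this way. *)
Lemma rip_inj x y : (forall z, rip x z = rip y z) -> x = y.
Proof.
move=> h; apply/subr0_eq/rip0_eq0; rewrite ripDl ripNl h; lra.
Qed.
Lemma nm_le x (C : R) : 0 <= C -> rip x x <= C ^+ 2 -> nm x <= C.
Proof. by move=> C0; rewrite -nmK ler_pXn2r ?nnegrE ?nm_ge0. Qed.

Lemma rip_cs x y : `|rip x y| <= nm x * nm y.
Proof.
have [y0|y0] := eqVneq (nm y) 0; first by rewrite (nm0_eq0 y0) rip0r nm0 normr0 mulr0.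
have yp : 0 < nm y by rewrite lt0r y0 nm_ge0.
have [x0|x0] := eqVneq (nm x) 0; first by rewrite (nm0_eq0 x0) rip0l nm0 normr0 mul0r.
have xp : 0 < nm x by rewrite lt0r x0 nm_ge0.
(* The squared norms of [|y| x + |x| y] and [|y| x - |x| y] give the two signs of the bound. *)
have h1 := rip_ge0 ((nm y)%:C *: x + (nm x)%:C *: y).
have h2 := rip_ge0 ((nm y)%:C *: x - (nm x)%:C *: y).
rewrite !ripE -!nmK (ripC y x) in h1 h2.
have p : 0 < 2 * (nm x * nm y) by rewrite !mulr_gt0.
rewrite ler_norml; apply/andP; split; rewrite -(ler_pM2l p); nra.
Qed.
End RealHilbert.

(** * Sequences and bounded operators *)

Section Sequences.
Variables (R : realType) (H : completeNormedModType R[i]).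
Implicit Types (x y z : H) (T S : H -> H) (e c : R).

Definition cv (u : nat -> H) (l : H) : Prop :=
  forall e, 0 < e -> exists n0 : nat, forall n, (n0 <= n)%N -> nm (u n - l) <= e.

Lemma cv_cst l : cv (fun=> l) l.
Proof. by move=> e e0; exists 0%N => n _; rewrite subrr nm0 ltW. Qed.

Lemma cv_uniq u l l' : cv u l -> cv u l' -> l = l'.
Proof.
move=> ul ul'; apply/subr0_eq/nm0_eq0/le_anti/andP; split; last exact: nm_ge0.
apply/ler_addgt0Pl => e e0; rewrite addr0.
have e2 : 0 < e / 2 by lra.
have [n1 h1] := ul _ e2; have [n2 h2] := ul' _ e2.
have /h1 a1 := leq_maxl n1 n2; have /h2 a2 := leq_maxr n1 n2.
have -> : l - l' = (u (maxn n1 n2) - l') - (u (maxn n1 n2) - l).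
  by rewrite opprB [RHS]addrC subrKA.
have := nmB (u (maxn n1 n2) - l') (u (maxn n1 n2) - l); lra.
Qed.

Lemma cvS u l : cv u l -> cv (fun n => u n.+1) l.
Proof. by move=> ul e /ul [n h]; exists n => m nm; apply: h; exact: leqW. Qed.

Lemma cvD u l v m : cv u l -> cv v m -> cv (fun n => u n + v n) (l + m).
Proof.
move=> ul vm e e0; have e2 : 0 < e / 2 by lra.
have [n1 h1] := ul _ e2; have [n2 h2] := vm _ e2.
exists (maxn n1 n2) => n; rewrite geq_max => /andP[/h1 a1 /h2 a2].
rewrite opprD addrACA; have := nmD (u n - l) (v n - m); lra.
Qed.

Lemma cv_complete u :
  (forall e, 0 < e -> exists n0 : nat, forall n, (n0 <= n)%N -> nm (u n - u n0) <= e) ->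
  exists l, cv u l.
Proof.
move=> uc; have /cauchy_cvg/cvg_ex[l /cvgrPdist_le ul] : cauchy (u @ \oo).
  apply: cauchy_exP => e e0.
  have er : e = (complex.Re e)%:C by rewrite RRe_real // gtr0_real.
  have er0 : 0 < complex.Re e by rewrite -ltcR -er.
  have [n0 hn] := uc (complex.Re e / 2) ltac:(lra).
  exists (u n0); exists n0 => // n /hn h.
  rewrite -ball_normE /ball_ /= distrC normE er ltcR; lra.
exists l => e e0; have [n0 _ hn] := ul e%:C ltac:(by rewrite ltcR).
by exists n0 => n /hn; rewrite distrC normE lecR.
Qed.

Lemma linB T : linear T -> {morph T : x y / x - y}.
Proof.
by move=> lT x y; have := lT (-1) y x; rewrite !scaleN1r => h; rewrite addrC h addrC.
Qed.
Lemma lin0 T : linear T -> T 0 = 0.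
Proof. by move=> /linB/(_ 0 0); rewrite subr0 subrr. Qed.
Lemma linZ T : linear T -> forall a : R[i], {morph T : x / a *: x}.
Proof. by move=> lT a x; rewrite -[a *: x]addr0 lT lin0 // addr0. Qed.
Lemma linD T : linear T -> {morph T : x y / x + y}.
Proof. by move=> lT x y; rewrite -[x]scale1r lT !scale1r. Qed.
Lemma linN T : linear T -> {morph T : x / - x}.
Proof. by move=> lT x; rewrite -scaleN1r linZ // scaleN1r. Qed.

Lemma cvZ (a : R[i]) u l : cv u l -> cv (fun n => a *: u n) (a *: l).
Proof.
move=> ul e e0; pose b := complex.Re `|a|.
have bE : `|a| = b%:C by rewrite /b RRe_real // ger0_real.
have b0 : 0 <= b by rewrite -ler0c -bE.
have [n0 hn] := ul (e / (b + 1)) ltac:(by rewrite divr_gt0 // ltr_wpDl).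
exists n0 => n /hn; rewrite ler_pdivlMr ?ltr_wpDl // => h.
rewrite -scalerBr -lecR -normE normrZ bE normE -rmorphM lecR.
by have := nm_ge0 (u n - l); nra.
Qed.

(** Boundedness with an explicit constant; for linear maps it amounts to continuity, by
    [lop_bounded_ops] and [bounded_ops_lop]. *)
Definition lop T : Prop :=
  linear T /\ exists C : R, forall x, nm (T x) <= C * nm x.

Lemma lop_bound T : lop T -> exists2 C : R, 0 < C & forall x, nm (T x) <= C * nm x.
Proof.
case=> lT [C hC]; exists (`|C| + 1); first by rewrite ltr_wpDl.
move=> x; apply: le_trans (hC x) _; apply: ler_wpM2r; first exact: nm_ge0.
by apply: le_trans (ler_norm C) _; rewrite lerDl.
Qed.

Lemma cv_lop T u l : lop T -> cv u l -> cv (fun n => T (u n)) (T l).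
Proof.
move=> lT ul e e0; have [C C0 hC] := lop_bound lT.
have [n0 hn] := ul (e / C) ltac:(by rewrite divr_gt0).
exists n0 => n /hn h; rewrite -(linB lT.1); apply: le_trans (hC _) _.
by rewrite mulrC -ler_pdivlMr.
Qed.

Lemma lop_id : lop id.
Proof. by split=> //; exists 1 => x; rewrite mul1r. Qed.

Lemma lop_comp T S : lop T -> lop S -> lop (T \o S).
Proof.
move=> lT lS; have [C C0 hC] := lop_bound lT; have [D D0 hD] := lop_bound lS.
split=> [a x y /=|]; first by rewrite lS.1 lT.1.
exists (C * D) => x /=; apply: le_trans (hC _) _.
by rewrite -mulrA ler_pM2l.
Qed.

Lemma linear_comb c T S : linear T -> linear S -> linear (fun x => c%:C *: T x + S x).
Proof.
by move=> lT lS a x y; rewrite lS lT !scalerDr !scalerA mulrC addrACA.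
Qed.

Lemma lop_lin c T S : lop T -> lop S -> lop (fun x => c%:C *: T x + S x).
Proof.
move=> lT lS; have [C C0 hC] := lop_bound lT; have [D D0 hD] := lop_bound lS.
split; first exact: linear_comb lT.1 lS.1.
exists (`|c| * C + D) => x /=; apply: le_trans (nmD _ _) _; rewrite nmZ.
by rewrite mulrDl lerD // -mulrA ler_wpM2l.
Qed.

Lemma lop_bounded_ops T : lop T -> bounded_ops T.
Proof.
move=> lT; split; first exact: lT.1.
have [C C0 hC] := lop_bound lT => x.
apply/cvgrPdist_le => e e0.
have er : e = (complex.Re e)%:C by rewrite RRe_real // gtr0_real.
have er0 : 0 < complex.Re e by rewrite -ltcR -er.
near=> y; rewrite -(linB lT.1) normE er lecR; apply: le_trans (hC _) _.
rewrite mulrC -ler_pdivlMr // -lecR -normE; near: y.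
apply: cvgr_dist_le; first exact: cvg_id.
by rewrite ltcR divr_gt0.
Unshelve. all: end_near.
Qed.

(* [neu D n] is the partial sum [1 + D + ... + D^(n-1)] of the Neumann series. *)
Fixpoint neu (D : H -> H) (n : nat) x : H :=
  if n is m.+1 then x + D (neu D m x) else 0.

Lemma expr_small (t : R) e : 0 <= t < 1 -> 0 < e -> exists n, t ^+ n <= e.
Proof.
move=> /andP[t0 t1] e0.
(* A Bernoulli-type inequality, which forces [t ^+ n] to decay at least like [1 / (n (1 - t))]. *)
have h (n : nat) : t ^+ n * (1 + n%:R * (1 - t)) <= 1.
  elim: n => [|n IH]; first by rewrite expr0 mul0r addr0 mulr1.
  apply: le_trans IH; rewrite exprS -mulrA mulrCA ler_wpM2l ?exprn_ge0 //.
  rewrite -natr1; have : 0 <= (n%:R + 1) * (1 - t) ^+ 2 by rewrite mulr_ge0 ?sqr_ge0 // addr_ge0.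
  lra.
have d0 : 0 < (1 - t) * e by rewrite mulr_gt0 // subr_gt0.
have [n hn] : exists n : nat, ((1 - t) * e)^-1 < n%:R.
  by exists (Num.truncn ((1 - t) * e)^-1).+1; rewrite truncnS_gt.
exists n; have := h n; have := exprn_ge0 n t0.
have : 1 < n%:R * ((1 - t) * e) by rewrite -ltr_pdivrMr // div1r.
set p := t ^+ n; set m : R := n%:R => h1 p0 h2.
rewrite leNgt; apply/negP => ep.
have m0 : 0 <= m by rewrite /m.
have : e * (1 + m * (1 - t)) <= p * (1 + m * (1 - t)).
  by rewrite ler_wpM2r ?(ltW ep) // addr_ge0 // mulr_ge0 // subr_ge0 ltW.
have := h1; rewrite /p; nra.
Qed.

(** The partial sums are bounded by [b1], hence Cauchy by [b2]. Their strong convergence is part of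
    the conclusion because [alt] is closed under strong limits only. *)
Lemma neumann D (t : R) : linear D -> 0 <= t < 1 ->
  (forall x, nm (D x) <= t * nm x) ->
  exists S, [/\ lop S, forall x, S x = x + D (S x) &
    forall x, cv (fun n => neu D n x) (S x)].
Proof.
move=> lD t01 hD; have /andP[t0 t1] := t01.
have lopD : lop D by split=> //; exists t.
have b1 n x : nm (neu D n x) <= (1 - t)^-1 * nm x.
  rewrite mulrC ler_pdivlMr ?subr_gt0 //.
  elim: n => [|n IH] /=; first by rewrite nm0 mul0r nm_ge0.
  have := nmD x (D (neu D n x)); have := hD (neu D n x); have := nm_ge0 x.
  by have := nm_ge0 (neu D n x); nra.
have b2 n k x : nm (neu D (n + k) x - neu D n x) <= t ^+ n * nm (neu D k x).
  elim: n => [|n IH]; first by rewrite add0n subr0 mul1r.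
  rewrite addSn /= opprD addrACA subrr add0r -(linB lD).
  by apply: le_trans (hD _) _; rewrite exprS -mulrA ler_wpM2l.
have ex x : exists l, cv (fun n => neu D n x) l.
  apply: cv_complete => e e0; pose A := (1 - t)^-1 * nm x.
  have A0 : 0 <= A by rewrite mulr_ge0 ?nm_ge0 // invr_ge0 subr_ge0 ltW.
  have [n hn] := expr_small t01 (divr_gt0 e0 (ltr_wpDl A0 ltr01)).
  exists n => m /subnKC <-; apply: le_trans (b2 _ _ _) _.
  apply: (@le_trans _ _ (t ^+ n * A)); first by rewrite ler_wpM2l ?exprn_ge0 // b1.
  move: hn; rewrite ler_pdivlMr ?ltr_wpDl // => hn; apply: le_trans hn.
  by rewrite ler_wpM2l ?exprn_ge0 // lerDl.
have [S hS] := choice ex.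
have linn n : linear (neu D n).
  elim: n => [|n IH] a x y /=; first by rewrite scaler0 addr0.
  by rewrite IH lD scalerDr addrACA.
have lopn n : lop (neu D n) by split=> //; exists (1 - t)^-1 => x.
exists S; split=> //; last first.
  move=> x; apply: (@cv_uniq (fun n => neu D n.+1 x)); first exact: (cvS (hS x)).
  by apply: cvD; [exact: cv_cst | exact: cv_lop].
split=> [a x y|].
  apply: (@cv_uniq (fun n => neu D n (a *: x + y))); first exact: hS.
  have -> : (fun n => neu D n (a *: x + y)) = (fun n => a *: neu D n x + neu D n y).
    by apply: funext => n; rewrite linn.
  by apply: cvD => //; exact: cvZ.
exists (1 - t)^-1 => x; apply/ler_addgt0Pl => e e0.
have [n /(_ n (leqnn n)) hn] := hS x e e0.
have := nmB (neu D n x) (neu D n x - S x); rewrite opprB addrC subrK => h.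
by apply: le_trans h _; rewrite addrC lerD.
Qed.

End Sequences.

(** * Positive operators and resolvents *)

Section PositiveOperators.
Variables (R : realType) (H : completeNormedModType R[i]).
Variable ip : {dot H for @conjC R[i]}.
Hypothesis hH : is_hilbert ip.
Local Notation rp := (rip ip).
Implicit Types (x y z : H) (T S k : H -> H) (c t C : R).

Definition sym T := forall x y, rp (T x) y = rp x (T y).

Lemma adj_rip T S : adjoint ip T S -> forall x y, rp (T x) y = rp x (S y).
Proof. by move=> h x y; rewrite /rip h. Qed.

(** Testing the symmetry at ['i *: x] as well recovers the imaginary part. *)
Lemma sym_adjoint T : linear T -> sym T -> adjoint ip T T.
Proof.
move=> lT sT x y; have := sT x y; have := sT ('i *: x) y.
rewrite linZ // /rip !linearZl_LR /=.
by case: (ip (T x) y) (ip x (T y)) => [a b] [a' b'] /=; rewrite !mul0r !mul1r !sub0r => /oppr_inj -> ->.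
Qed.

Definition posop T t : Prop :=
  [/\ linear T, sym T & forall x, 0 <= rp (T x) x <= t * rp x x].

(** This is [T^2 <= t T]: combine positivity of the form at [t x - T x] with its upper bound at
    [T x]. *)
Lemma pos_cs T t x : 0 < t -> posop T t -> rp (T x) (T x) <= t * rp (T x) x.
Proof.
move=> t0 [lT sT bT].
have /andP[h _] := bT (t%:C *: x - T x); have /andP[_ h'] := bT (T x).
move: h; rewrite (linB lT) (linZ lT) !ripE (sT (T x) x) => h.
rewrite -(ler_pM2l t0); nra.
Qed.

Lemma posop_nm T t x : 0 < t -> posop T t -> nm (T x) <= t * nm x.
Proof.
move=> t0 pT; apply: (nm_le hH); first by rewrite mulr_ge0 ?nm_ge0 // ltW.
rewrite exprMn (nmK hH); have := pos_cs x t0 pT; have [_ _ /(_ x)] := pT.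
by move=> /andP[_ h]; rewrite -(ler_pM2l t0) in h; lra.
Qed.

Lemma posop_lop T t : 0 < t -> posop T t -> lop T.
Proof.
move=> t0 pT; split; first by case: pT.
by exists t => x; exact: posop_nm.
Qed.

(** The operator [T + t] is positive with bound [2 t], and [pos_cs] for it simplifies to
    [|T x|^2 <= t^2 |x|^2]. *)
Lemma sym_nm T t x : 0 < t -> linear T -> sym T ->
  (forall x, `|rp (T x) x| <= t * rp x x) -> nm (T x) <= t * nm x.
Proof.
move=> t0 lT sT bT; apply: (nm_le hH); first by rewrite mulr_ge0 ?nm_ge0 // ltW.
rewrite exprMn (nmK hH).
have pT : posop (fun x => T x + t%:C *: x) (2 * t).
  split=> [a u v|u v|u]; first by rewrite lT !scalerDr !scalerA mulrC addrACA.
    by rewrite !ripE sT.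
  by have := bT u; rewrite ler_norml !ripE => /andP[]; lra.
have t2 : 0 < 2 * t by lra.
have := pos_cs x t2 pT; rewrite !ripE (sT x x); lra.
Qed.

Lemma sym_form_sub k x y : linear k -> sym k ->
  rp (k (x - y)) (x - y) = rp (k x) x - 2 * rp x (k y) + rp (k y) y.
Proof.
by move=> lk sk; rewrite (linB lk) !ripE (sk x y) (ripC ip (k y) x); ring.
Qed.

Lemma cv_rip_le u l z c : cv u l -> (forall n, rp (u n) z <= c) -> rp l z <= c.
Proof.
move=> ul h; apply/ler_addgt0Pl => e e0.
have z0 := nm_ge0 z.
have [n /(_ n (leqnn n)) hn] := ul (e / (nm z + 1)) ltac:(by rewrite divr_gt0 // ltr_wpDl).
move: hn; rewrite ler_pdivlMr ?ltr_wpDl // => hn.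
have := rip_cs hH (u n - l) z; rewrite !ripE ler_norml => /andP[h1 _].
have := h n; have := nm_ge0 (u n - l); nra.
Qed.

Lemma cv_rip_ge u l z c : cv u l -> (forall n, c <= rp (u n) z) -> c <= rp l z.
Proof.
move=> ul h; rewrite -lerN2 -ripNr; apply: (cv_rip_le ul) => n.
by rewrite ripNr lerN2.
Qed.

Lemma cv_rip_eq u v l m y z : cv u l -> cv v m ->
  (forall n, rp (u n) y = rp (v n) z) -> rp l y = rp m z.
Proof.
move=> ul vm h.
suff : forall e : R, 0 < e -> `|rp l y - rp m z| <= e.
  move=> h'; apply/subr0_eq/eqP; rewrite -normr_le0.
  by apply/ler_addgt0Pl => e e0; rewrite addr0 h'.
move=> e e0; pose A := nm y + nm z + 1.
have y0 := nm_ge0 y; have z0 := nm_ge0 z.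
have A0 : 0 < A by rewrite /A; lra.
have [n1 h1] := ul (e / A / 2) ltac:(by rewrite !divr_gt0).
have [n2 h2] := vm (e / A / 2) ltac:(by rewrite !divr_gt0).
pose n := maxn n1 n2.
have /h1 a1 := leq_maxl n1 n2; have /h2 a2 := leq_maxr n1 n2.
rewrite -/n !ler_pdivlMr // in a1 a2.
have := rip_cs hH (u n - l) y; have := rip_cs hH (v n - m) z.
rewrite !ripE !ler_norml h.
have := nm_ge0 (u n - l); have := nm_ge0 (v n - m); rewrite /A in a1 a2.
by move=> p1 p2 /andP[q1 q2] /andP[q3 q4]; apply/andP; split; nra.
Qed.

Lemma posop_id_sub T : posop T 1 -> posop (fun x => x - T x) 1.
Proof.
move=> [lT sT bT]; split=> [a x y|x y|x].
- by rewrite lT scalerBr opprD addrACA.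
- by rewrite !ripE sT.
- by have := bT x; rewrite !ripE; lra.
Qed.

(** * Strong limits of monotone sequences of positive contractions *)

Lemma nonincr_cauchy (u : nat -> R) b : (forall n, u n.+1 <= u n) -> (forall n, b <= u n) ->
  forall e, 0 < e -> exists n0, forall n, (n0 <= n)%N -> u n0 - u n <= e.
Proof.
move=> du bu e e0.
have hi : has_inf (range u).
  by split; [exists (u 0%N); exists 0%N | exists b => _ [n _ <-]].
have [_ [n _ <-] hn] := inf_adherent e0 hi.
exists n => m _; have := ge_inf hi.2 (ex_intro2 _ _ m I erefl); lra.
Qed.

Lemma nonincr_le (u : nat -> R) : (forall n, u n.+1 <= u n) ->
  forall m n, (m <= n)%N -> u n <= u m.
Proof.
by move=> du m n /subnKC <-; elim: (n - m)%N => [|j IH]; rewrite ?addn0 // addnS (le_trans (du _)).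
Qed.

(* Monotone bounded sequences of positive operators converge strongly: for a
   positive contraction [D], [|D x|^2 <= <D x, x>]. *)
Lemma decreasing_limit (T : nat -> H -> H) :
  (forall n, posop (T n) 1) ->
  (forall n x, rp (T n.+1 x) x <= rp (T n x) x) ->
  exists S, posop S 1 /\ forall x, cv (fun n => T n x) (S x).
Proof.
move=> pT dT.
have pD n m : (n <= m)%N -> posop (fun x => T n x - T m x) 1.
  move=> nm; have [ln sn bn] := pT n; have [lm sm bm] := pT m.
  split=> [a x y|x y|x].
  - by rewrite ln lm scalerBr opprD addrACA.
  - by rewrite !ripE sn sm.
  - have := nonincr_le (fun j => dT j x) nm; have := bn x; have := bm x.
    by rewrite !ripE; lra.
have ex x : exists l, cv (fun n => T n x) l.
  apply: cv_complete => e e0.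
  have [n0 h] := nonincr_cauchy (fun j => dT j x) (fun n => proj1 (andP (let: And3 _ _ b := pT n in b x)))
     (exprn_gt0 2 e0).
  exists n0 => n nn; apply: (nm_le hH); first exact: ltW.
  have := pos_cs x ltr01 (pD _ _ nn); have := h _ nn; rewrite !ripE; lra.
have [S hS] := choice ex; exists S; split=> //; split=> [a x y|x y|x].
- apply: (@cv_uniq _ _ (fun n => T n (a *: x + y))); first exact: hS.
  have -> : (fun n => T n (a *: x + y)) = (fun n => a *: T n x + T n y).
    by apply: funext => n; have [-> //] := pT n.
  by apply: cvD => //; exact: cvZ.
- rewrite (ripC ip x); apply: (cv_rip_eq (hS x) (hS y)) => n.
  by have [_ -> _] := pT n; rewrite ripC.
- apply/andP; split.
    by apply: (cv_rip_ge (hS x)) => n; have [_ _ /(_ x)/andP[]] := pT n.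
  by apply: (cv_rip_le (hS x)) => n; have [_ _ /(_ x)/andP[]] := pT n.
Qed.

Lemma increasing_limit (T : nat -> H -> H) :
  (forall n, posop (T n) 1) ->
  (forall n x, rp (T n x) x <= rp (T n.+1 x) x) ->
  exists S, posop S 1 /\ forall x, cv (fun n => T n x) (S x).
Proof.
move=> pT dT.
have [||S [pS cS]] := @decreasing_limit (fun n x => x - T n x).
- by move=> n; exact: posop_id_sub.
- by move=> n x; have := dT n x; rewrite !ripE; lra.
exists (fun x => x - S x); split; first exact: posop_id_sub.
move=> x; have -> : (fun n => T n x) = (fun n => x + (-1) *: (x - T n x)).
  by apply: funext => n; rewrite scaleN1r opprB addrC subrK.
by rewrite -(scaleN1r (S x)); apply: cvD; [exact: cv_cst | exact: cvZ].
Qed.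

(** * Resolvents of positive operators *)

Definition res k c : H -> H := fun y => xget 0 [set x | x + c%:C *: k x = y].

Section Resolvent.
Variables (k : H -> H) (C c : R).
Hypotheses (C0 : 0 <= C) (pk : posop k C) (c0 : 0 <= c).

(** With [m = 1 / (1 + c C)], the operator [D = 1 - m (1 + c k)] is positive of norm below 1, so a
    Neumann series inverts [m (1 + c k)]. Existence of a solution ensures that [xget] in [res]
    returns one rather than the default [0]. *)
Lemma resP y : res k c y + c%:C *: k (res k c y) = y.
Proof.
have [lk sk bk] := pk; have cC : 0 <= c * C by rewrite mulr_ge0.
pose m := (1 + c * C)^-1.
have m0 : 0 < m by rewrite invr_gt0; lra.
have mE : m * (1 + c * C) = 1 by rewrite mulVf //; apply/eqP; lra.
(* Since [m + m c C = 1], this is [1 - m / 2]; the term [m / 2] keeps [t] positive when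
   [c C = 0]. *)
pose t := m * c * C + m / 2.
pose D x := (- m)%:C *: (c%:C *: k x + x) + x.
have t0 : 0 < t by rewrite /t; nra.
have t1 : t < 1 by rewrite /t; nra.
have pD : posop D t.
  split=> [|u v|u]; rewrite /D.
  - by apply: linear_comb => //; exact: linear_comb.
  - by rewrite !ripE sk.
  - have := bk u; rewrite !ripE => /andP[h1 h2].
    have h3 := rip_ge0 hH u.
    have h4 : 0 <= m * c * (C * rp u u - rp (k u) u).
      by rewrite !mulr_ge0 ?subr_ge0 // ltW.
    have h5 : 0 <= m * c * rp (k u) u by rewrite !mulr_ge0 // ltW.
    have h6 : 0 <= m * rp u u by rewrite mulr_ge0 // ltW.
    have h7 : rp u u = m * (1 + c * C) * rp u u by rewrite mE mul1r.
    rewrite /t; lra.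
have [lD _ _] := pD.
have t01 : 0 <= t < 1 by rewrite (ltW t0).
have [S [lS eS _]] := neumann lD t01 (fun x => posop_nm x t0 pD).
rewrite /res; case: xgetP => [x -> //| /(_ (m%:C *: S y))] []; rewrite /=.
rewrite [RHS](_ : y = S y - D (S y)); last by rewrite {1}eS addrK.
rewrite /D opprD addrA (addrC (S y)) addrK (linZ lk) scalerDr !scalerA.
by rewrite rmorphN /= scaleNr mulNr scaleNr opprB opprK (mulrC m%:C).
Qed.

Lemma res_uniq x y : x + c%:C *: k x = y -> res k c y = x.
Proof.
have [lk sk bk] := pk.
move=> xy; set u := res k c y.
have h : u + c%:C *: k u = x + c%:C *: k x by rewrite xy resP.
apply/subr0_eq/(rip0_eq0 hH).
have : (u - x) + c%:C *: k (u - x) = 0.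
  by rewrite (linB lk) scalerBr addrACA -opprD h subrr.
move=> /(congr1 (fun v => rp v (u - x))); rewrite [LHS]ripDl ripZl rip0l.
have /andP[h1 _] := bk (u - x); have := rip_ge0 hH (u - x).
by have := mulr_ge0 c0 h1; lra.
Qed.

Lemma res_linear : linear (res k c).
Proof.
have [lk sk bk] := pk => a x y; apply: res_uniq.
rewrite lk scalerDr scalerA mulrC -scalerA addrACA -scalerDr !resP //.
Qed.

Lemma res_sym : sym (res k c).
Proof.
have [lk sk bk] := pk => x y.
rewrite -{1}(resP y) -{2}(resP x) !ripE sk //.
Qed.

Lemma res_form x : rp (res k c x) x =
  rp (res k c x) (res k c x) + c * rp (k (res k c x)) (res k c x).
Proof. by rewrite -{2}(resP x) !ripE (ripC ip _ (k _)). Qed.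

Lemma res_posop : posop (res k c) 1.
Proof.
have [lk sk bk] := pk; split; [exact: res_linear|exact: res_sym|move=> x].
have /andP[h1 _] := bk (res k c x).
have h2 := rip_ge0 hH (res k c x); have h3 := mulr_ge0 c0 h1.
rewrite mul1r; apply/andP; split; first by rewrite res_form; lra.
have := rip_ge0 hH (x - res k c x); rewrite !ripE (ripC ip x) => h4.
have := res_form x; lra.
Qed.

(** The bound does not involve [C], so it is uniform along forms whose bounds grow. *)
Lemma res_energy x : c * rp (k (res k c x)) (res k c x) <= rp x x.
Proof.
have [_ _ /(_ x)/andP[_]] := res_posop; rewrite res_form.
by have := rip_ge0 hH (res k c x); lra.
Qed.

(** With [y] the resolvent at [x], [x = y + c k y] gives [|x| <= (1 + c C) |y|], while
    [<y, x> >= |y|^2]. Being strictly positive, the bound later makes [rho] a strict contraction. *)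
Lemma res_lower x : (1 + c * C) ^- 2 * rp x x <= rp (res k c x) x.
Proof.
have [lk sk bk] := pk; set y := res k c x.
have cC : 0 <= c * C by rewrite mulr_ge0.
have b0 : 0 < 1 + c * C by lra.
have h : nm x <= (1 + c * C) * nm y.
  rewrite -(resP x) -/y; apply: le_trans (nmD _ _) _.
  rewrite nmZ ger0_norm // mulrDl mul1r lerD2l -mulrA ler_wpM2l //.
  (* [posop_nm] asks for a positive bound, so the case [C = 0], where [k y] vanishes, is treated
     apart. *)
  have [C00|Cp] := eqVneq C 0; last by apply: posop_nm => //; rewrite lt0r Cp.
  have : posop k 1.
    split=> // u; have /andP[-> h] := bk u; apply: le_trans h _.
    by rewrite C00 mul0r mul1r rip_ge0.
  move=> p1; have := pos_cs y ltr01 p1; have := bk y; rewrite C00 !mul0r mul1r => h1 h2.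
  by rewrite (rip0_eq0 hH (x := k y)) ?nm0 //; have := rip_ge0 hH (k y); lra.
have /andP[h1 _] := bk y.
rewrite mulrC ler_pdivrMr ?exprn_gt0 //; have := res_form x; rewrite -/y => ->.
have h3 := mulr_ge0 c0 h1.
have : nm x ^+ 2 <= ((1 + c * C) * nm y) ^+ 2.
  by rewrite ler_pXn2r // nnegrE ?mulr_ge0 ?nm_ge0 // ltW.
rewrite exprMn !(nmK hH) => h4; apply: le_trans h4 _.
by rewrite mulrC ler_wpM2r ?sqr_ge0 // lerDl.
Qed.

Lemma res_comm S : linear S -> (forall x, k (S x) = S (k x)) ->
  forall x, res k c (S x) = S (res k c x).
Proof.
by move=> lS kS x; apply: res_uniq; rewrite kS -(linZ lS) -(linD lS) resP.
Qed.

(** With [y] the resolvent at [x], [x - y = c k y] and [<k x, x> - <k y, x> = c <k x, k y> >= 0]. *)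
Lemma res_defect x : rp (x - res k c x) x <= c * rp (k x) x.
Proof.
have [lk sk bk] := pk; set y := res k c x.
have hx : x - y = c%:C *: k y by rewrite -{1}(resP x) -/y addrC addKr.
have h1 : rp (k x) x - rp (k y) x = c * rp (k x) (k y).
  by rewrite (sk y) (ripC ip y) -ripNr -ripDr hx ripZr.
have h2 : 0 <= rp (k x) (k y).
  rewrite -{1}(resP x) -/y (linD lk) (linZ lk) !ripE.
  by rewrite addr_ge0 ?rip_ge0 // mulr_ge0 //; have /andP[] := bk (k y).
rewrite hx ripZl ler_wpM2l // -subr_ge0 h1 mulr_ge0 //.
Qed.

End Resolvent.

(** Expand the nonnegative form of [1 + c k] at [y - y'], where [y] and [y'] are the two resolvents
    at [x], and bound [c k] by [c' k'] at [y']. *)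
Lemma res_antitone k k' C C' c c' x : 0 <= C -> 0 <= C' -> posop k C -> posop k' C' ->
  0 <= c -> c <= c' -> (forall x, rp (k x) x <= rp (k' x) x) ->
  rp (res k' c' x) x <= rp (res k c x) x.
Proof.
move=> C0 C0' pk pk' c0 cc' kk'; have c0' := le_trans c0 cc'.
have e := resP C0 pk c0 x; have f := res_form C0' pk' c0' x.
set y := res k c x in e *; set y' := res k' c' x in f *.
have [lk sk bk] := pk.
have g : rp y x = rp y y + c * rp (k y) y := res_form C0 pk c0 x.
have := rip_ge0 hH (y - y'); have /andP[] := bk (y - y').
rewrite (linB lk) !ripE => h1 _ h2.
have h3 : rp y' x = rp y' y + c * rp y' (k y) by rewrite -e !ripE.
have h4 := kk' y'; have /andP[h5 _] := bk y'.
have h6 : c * rp (k y') y' <= c' * rp (k' y') y' by apply: ler_pM.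
have e1 := ripC ip y' y; have e2 := ripC ip y' (k y); have e3 := sk y' y.
have h7 := mulr_ge0 c0 h1; rewrite e3 e2 in h7; rewrite e1 in h2; rewrite e1 e2 in h3.
lra.
Qed.

Lemma res_lipschitz k C c c' x : 0 <= C -> posop k C -> 0 <= c -> c <= c' ->
  rp (res k c x) x - rp (res k c' x) x <= C * (c' - c) * rp x x.
Proof.
move=> C0 pk c0 cc'; have c0' := le_trans c0 cc'; have [lk sk bk] := pk.
have [C00|Cp] := eqVneq C 0.
  have k0 u : k u = 0.
    have p1 : posop k 1.
      split=> // v; have /andP[-> h] := bk v; apply: le_trans h _.
      by rewrite C00 mul0r mul1r rip_ge0.
    apply: (rip0_eq0 hH); have := pos_cs u ltr01 p1; have := bk u.
    by rewrite C00 !mul0r mul1r; have := rip_ge0 hH (k u); lra.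
  by rewrite !(@res_uniq k C _ C0 pk _ x x) ?k0 ?scaler0 ?addr0 // C00 !mul0r subrr.
have e := resP C0 pk c0 x; have e' := resP C0 pk c0' x.
have y1 := posop_nm x ltr01 (res_posop C0 pk c0).
have y1' := posop_nm x ltr01 (res_posop C0 pk c0').
set y := res k c x in e y1 *; set y' := res k c' x in e' y1' *.
(* The resolvent identity, tested at [x]. *)
have -> : rp y x - rp y' x = (c' - c) * rp (k y) y'.
  have : rp y x = rp y y' + c' * rp y (k y') by rewrite -{1}e' !ripE.
  have : rp y' x = rp y' y + c * rp y' (k y) by rewrite -{1}e !ripE.
  by rewrite (ripC ip y' y) (ripC ip y' (k y)) -(sk y y') => -> ->; lra.
rewrite (mulrC C) -mulrA; apply: ler_wpM2l; first by rewrite subr_ge0.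
have := rip_cs hH (k y) y'; rewrite ler_norml => /andP[_ h].
have k1 := posop_nm y (t := C) ltac:(by rewrite lt0r Cp) pk.
apply: le_trans h _; rewrite -(nmK hH) expr2 mulrA; rewrite mul1r in y1 y1'.
by apply: ler_pM; rewrite ?nm_ge0 //; apply: le_trans k1 _; rewrite ler_wpM2l.
Qed.

End PositiveOperators.

(** * Free pairs of matrix units *)

Section FreeMatrixUnits.
Variables (R : realType) (H : completeNormedModType R[i]).
Variable ip : {dot H for @conjC R[i]}.
Hypothesis hH : is_hilbert ip.
Local Notation rp := (rip ip).
Variables (e f : bool -> H -> H) (Omega : H).
Hypotheses (he : forall i, linear (e i)) (hf : forall i, linear (f i)).
Hypothesis ef_adj : forall i x y, rp (e i x) y = rp x (f i y).
Hypotheses (ee : forall i x, e i (e i x) = 0) (ff : forall i x, f i (f i x) = 0).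
Hypothesis effe : forall i x, e i (f i x) + f i (e i x) = x.
Hypothesis Omega1 : rp Omega Omega = 1.
Implicit Types (x y z : H) (i : bool) (c t h : R).

(** This is [E11 - E22], a self-adjoint unitary; together with [e i] and [f i] it spans the matrices
    of trace zero. *)
Definition jj i x := e i (f i x) - f i (e i x).

Definition letter i (T : H -> H) := [\/ T = e i, T = f i | T = jj i].

(** The two booleans record the copies of the first and the last letter, so that concatenation can
    be checked for alternation. *)
Inductive word : bool -> bool -> (H -> H) -> Prop :=
| word1 i T of letter i T : word i i T
| wordS i j T W of letter i T & word (~~ i) j W : word i j (T \o W).

(** Freeness enters the section in this form. *)
Hypothesis word_trace0 : forall i j W, word i j W -> rp (W Omega) Omega = 0.

Lemma efe i x : e i (f i (e i x)) = e i x.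
Proof. by rewrite -{2}(effe i x) (linD (he i)) ee add0r. Qed.
Lemma fef i x : f i (e i (f i x)) = f i x.
Proof. by rewrite -{2}(effe i x) (linD (hf i)) ff addr0. Qed.
Lemma jje i x : jj i (e i x) = e i x.
Proof. by rewrite /jj efe ee lin0 // subr0. Qed.
Lemma fjj i x : f i (jj i x) = f i x.
Proof. by rewrite /jj (linB (hf i)) fef ff subr0. Qed.
Lemma jjK i x : jj i (jj i x) = x.
Proof. by rewrite {1}/jj fjj /jj (linB (he i)) efe ee sub0r (linN (hf i)) opprK effe. Qed.
Lemma jj_linear i : linear (jj i).
Proof.
by move=> a x y; rewrite /jj hf !he hf scalerBr opprD addrACA.
Qed.
Lemma fe_adj i x y : rp (f i x) y = rp x (e i y).
Proof. by rewrite ripC -ef_adj ripC. Qed.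
Lemma ef_pyth i x : rp (e i x) (e i x) + rp (f i x) (f i x) = rp x x.
Proof. by rewrite ef_adj fe_adj -ripDr addrC effe. Qed.
Lemma e_nm i x : nm (e i x) <= nm x.
Proof.
apply: (nm_le hH); rewrite ?nm_ge0 // (nmK hH) -(ef_pyth i x).
by rewrite lerDl rip_ge0.
Qed.
Lemma f_nm i x : nm (f i x) <= nm x.
Proof.
apply: (nm_le hH); rewrite ?nm_ge0 // (nmK hH) -(ef_pyth i x).
by rewrite lerDr rip_ge0.
Qed.
Lemma jj_sym i : sym ip (jj i).
Proof. by move=> x y; rewrite /jj !ripE !(ef_adj, fe_adj). Qed.
Lemma jj_nm i x : nm (jj i x) <= nm x.
Proof.
apply: (nm_le hH); rewrite ?nm_ge0 // (nmK hH).
by rewrite jj_sym jjK.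
Qed.

Lemma letter_lop i T : letter i T -> lop T.
Proof.
case=> ->; split=> //; try (by exists 1 => x; rewrite mul1r ?e_nm ?f_nm ?jj_nm).
exact: jj_linear.
Qed.

Lemma word_lop i j W : word i j W -> lop W.
Proof.
by elim=> {}i => [T|{}j T {}W] /letter_lop // lT _ lW; exact: lop_comp.
Qed.

Lemma word_cat i j l V W : word i j V -> word (~~ j) l W -> word i l (V \o W).
Proof.
by move=> hV; elim: hV W => {}i => [T|{}j T V'] hT => [|_ IH] W hW;
  [exact: wordS | exact: (wordS hT (IH _ hW))].
Qed.

(* [alt i j] is the strongly closed span of the alternating words whose first
   letter is of type [i] and whose last letter is of type [j]. *)
Inductive alt : bool -> bool -> (H -> H) -> Prop :=
| alt_letter i T of letter i T : alt i i T
| alt_mul i j l S T of alt i j S & alt (~~ j) l T : alt i l (S \o T)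
| alt_lin i j c S T of alt i j S & alt i j T :
    alt i j (fun x => c%:C *: S x + T x)
| alt_lim i j (U : nat -> H -> H) T of (forall n, alt i j (U n)) &
    (forall x, cv (fun n => U n x) (T x)) : alt i j T.

(* Stated in all contexts [U _ V], vanishing of the trace is inherited by
   products. *)
Lemma alt_context i j T : alt i j T -> forall U V : H -> H, lop U ->
  (forall W, word i j W -> rp (U (W (V Omega))) Omega = 0) ->
  rp (U (T (V Omega))) Omega = 0.
Proof.
elim=> {i j T}.
- by move=> i T hT U V _; apply; exact: word1.
- move=> i j l S T _ IS _ IT U V lU hU.
  apply: (IS U (T \o V)) => // W hW.
  apply: (IT (U \o W) V); first exact: lop_comp (word_lop hW).
  by move=> W' hW'; apply: (hU (W \o W')); exact: word_cat hW'.
- move=> i j c S T _ IS _ IT U V lU hU.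
  by rewrite lU.1 !ripE (IS U V) // (IT U V) // mulr0 addr0.
- move=> i j Un T _ IU cU U V lU hU.
  rewrite -(rip0l ip Omega); apply: (cv_rip_eq hH (cv_lop lU (cU _)) (cv_cst 0)) => n.
  by rewrite rip0l; exact: (IU n U V).
Qed.

Lemma alt_trace0 i j T : alt i j T -> rp (T Omega) Omega = 0.
Proof.
move=> hT; apply: (alt_context hT (U := id) (V := id)) (@lop_id _ _) _.
by move=> W; exact: word_trace0.
Qed.

Lemma alt_ex i j : exists T, alt i j T.
Proof.
have le i' : alt i' i' (e i') by apply: alt_letter; constructor 1.
have [<-|/negPf ij] := eqVneq i j; first by exists (e i).
exists (e i \o e j); apply: (alt_mul (le i)).
by have := le j; case: i j ij => [] [].
Qed.

Lemma alt0 i j : alt i j (fun=> 0).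
Proof.
have [T hT] := alt_ex i j; have := alt_lin (-1) hT hT.
by congr alt; apply: funext => x; rewrite rmorphN1 scaleN1r addrC subrr.
Qed.

Lemma altZ i j c T : alt i j T -> alt i j (fun x => c%:C *: T x).
Proof.
move=> hT; have := alt_lin c hT (alt0 i j).
by congr alt; apply: funext => x; rewrite addr0.
Qed.

Lemma altD i j S T : alt i j S -> alt i j T -> alt i j (fun x => S x + T x).
Proof.
move=> hS hT; have := alt_lin 1 hS hT.
by congr alt; apply: funext => x; rewrite rmorph1 scale1r.
Qed.

(** * Weighted sums over alternating words *)

Variable s : R.
Hypothesis s0 : 0 < s.

(* The sum of [s^-m w^* w] over the alternating words [w] of length [0 < m <= n] in
   [e false] and [e true] which end in [e i]. *)
Fixpoint wsum n i x : H :=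
  if n is m.+1 then (s^-1)%:C *: f i (e i x + wsum m (~~ i) (e i x)) else 0.

(** The sum of [s^-m] over [0 < m <= n]: each length has one word with a given last letter, and that
    word is a contraction. *)
Fixpoint wbound n : R := if n is m.+1 then s^-1 * (1 + wbound m) else 0.

Lemma wbound_ge0 n : 0 <= wbound n.
Proof. by elim: n => //= n IH; rewrite mulr_ge0 ?invr_ge0 ?ltW // ltr_wpDr. Qed.

Lemma wsum_formS n i x : rp (wsum n.+1 i x) x =
  s^-1 * (rp (e i x) (e i x) + rp (wsum n (~~ i) (e i x)) (e i x)).
Proof. by rewrite /= ripZl fe_adj ripDl. Qed.

Lemma wsum_posop n i : posop ip (wsum n i) (wbound n).
Proof.
have s1 : 0 <= s^-1 by rewrite invr_ge0 ltW.
elim: n i => [|n IH] i.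
  split=> [a x y|x y|x] /=; first by rewrite scaler0 addr0.
      by rewrite !ripE.
  by rewrite !ripE mul0r lexx.
have [lk sk bk] := IH (~~ i); split=> [a x y|x y|x].
- rewrite /= he lk addrACA -scalerDr hf scalerDr !scalerA mulrC //.
- by rewrite /= !ripE fe_adj -ef_adj !ripE sk.
- rewrite wsum_formS; have /andP[h1 h2] := bk (e i x); have h3 := rip_ge0 hH (e i x).
  rewrite mulr_ge0 ?addr_ge0 //= -mulrA ler_wpM2l //.
  have : rp (e i x) (e i x) <= rp x x by rewrite -(ef_pyth i x) lerDl rip_ge0.
  by have := wbound_ge0 n; nra.
Qed.

Lemma wsum_incr n i x : rp (wsum n i x) x <= rp (wsum n.+1 i x) x.
Proof.
elim: n i x => [|n IH] i x.
  by rewrite [wsum 0 i x]/= rip0l; have [_ _ /(_ x)/andP[]] := wsum_posop 1 i.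
rewrite (wsum_formS n.+1) (wsum_formS n i x).
by rewrite ler_wpM2l ?invr_ge0 ?(ltW s0) // lerD2l.
Qed.

Definition wtot n x : H := wsum n false x + wsum n true x.

Lemma wtot_posop n : posop ip (wtot n) (2 * wbound n).
Proof.
have [l1 s1 b1] := wsum_posop n false; have [l2 s2 b2] := wsum_posop n true.
split=> [a x y|x y|x]; rewrite /wtot.
- by rewrite l1 l2 scalerDr addrACA.
- by rewrite !ripE s1 s2.
- by have := b1 x; have := b2 x; rewrite !ripE; lra.
Qed.

Lemma wtot_bound_ge0 n : 0 <= 2 * wbound n.
Proof. by rewrite mulr_ge0 // wbound_ge0. Qed.

(** * One step of the resolvent recursion *)

Section Step.
Variables (n : nat) (c h : R).
Hypotheses (c0 : 0 < c) (h0 : 1 / 2 < h) (h1 : h <= 1).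
Hypothesis altR : forall i, alt i i (fun x => res (wsum n i) c x - h%:C *: x).

(** By [altR] the resolvent has trace [h]; [rho i] is its normalized fluctuation, of trace zero. *)
Let rho i x : H := (h^-1)%:C *: res (wsum n i) c x - x.

Lemma rho_alt i : alt i i (rho i).
Proof.
have h00 : h != 0 by rewrite gt_eqF //; have := h0; lra.
have := altZ (h^-1) (altR i); congr alt; apply: funext => x.
by rewrite scalerBr scalerA -rmorphM mulVf // rmorph1 scale1r.
Qed.

Lemma rho_linear i : linear (rho i).
Proof.
have lr := res_linear hH (wbound_ge0 n) (wsum_posop n i) (ltW c0).
apply: (linear_comb (h^-1) lr (S := fun x => - x)) => a x y.
by rewrite opprD scalerN.
Qed.

(** The form of the resolvent lies between [d] and [1], so that of [rho] lies between [d - 1] and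
    [1 / h - 1]; the latter is below [1] because [h > 1 / 2]. *)
Lemma rho_contr : exists2 t, 0 < t < 1 & forall i x, nm (rho i x) <= t * nm x.
Proof.
have n0 := wbound_ge0 n; have h0' := h0; have h1' := h1.
pose d := (1 + c * wbound n) ^- 2.
have cb : 0 <= c * wbound n by rewrite mulr_ge0 // ltW.
have d0 : 0 < d by rewrite invr_gt0 exprn_gt0 //; lra.
have d1 : d <= 1 by rewrite invf_le1 ?exprn_gt0 ?exprn_ege1 //; lra.
have hi1 : 1 <= h^-1 by rewrite invf_ge1 //; lra.
have hi2 : h^-1 < 2 by rewrite -[2]invrK ltf_pV2 ?posrE; lra.
exists (Num.max (1 - d / 2) (h^-1 - 1)).
  by rewrite lt_max gt_max; apply/andP; split; [apply/orP; left|]; lra.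
move=> i x; set t := Num.max _ _.
have t1 : 1 - d / 2 <= t by rewrite le_max lexx.
have t2 : h^-1 - 1 <= t by rewrite le_max lexx orbT.
have pk := wsum_posop n i.
have [_ sr br] := res_posop hH n0 pk (ltW c0).
apply: (sym_nm hH); [lra | exact: rho_linear | |].
  by move=> u v; rewrite /rho !ripE sr.
move=> u; have /andP[_ b1] := br u; have b2 := res_lower hH n0 pk (ltW c0) u.
rewrite -/d in b2; have u0 := rip_ge0 hH u.
rewrite /rho !ripE ler_norml; set r := rp (res _ _ _) _ in b1 b2 *.
have b3 : h^-1 * r <= h^-1 * rp u u by rewrite ler_wpM2l //; lra.
have b4 : r <= h^-1 * r by rewrite ler_peMl //; nra.
apply/andP; split; nra.
Qed.

Lemma alt_comp i j l S T : alt i j S -> alt (~~ j) l T -> alt i l (fun x => S (T x)).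
Proof. exact: alt_mul. Qed.

Lemma rho_lop i : lop (rho i).
Proof.
have [t /andP[t0 _] ht] := rho_contr.
by split; [exact: rho_linear | exists t; exact: ht].
Qed.

(** As [v + rho i v] is the resolvent at [v / h], this is its defining equation. It eliminates
    [wsum n i] from the two computations below. *)
Lemma wsum_res i v : c%:C *: wsum n i (v + rho i v) = (h^-1)%:C *: v - (v + rho i v).
Proof.
have [lk _ _] := wsum_posop n i.
rewrite /rho addrC subrK (linZ lk) scalerA mulrC -scalerA -scalerBr; congr (_ *: _).
rewrite [RHS]addrC; apply: canRL (addKr _) _.
exact: (resP hH (wbound_ge0 n) (wsum_posop n i) (ltW c0) v).
Qed.

(* With [rho = R/h - 1], the corner of [2/(1 + rho) - 1] at [E11 = (1 + J)/2]
   has inverse [(1 + rho) / (1 - J rho)], a sum of alternating words. *)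
Lemma wsum_step i : 1 < 2 * h * (1 - c) ->
  alt i i (fun x => res (wsum n.+1 i) (2 * s * c * h / (2 * h * (1 - c) - 1)) x
                    - (h * (1 - c))%:C *: x).
Proof.
(* The constant part of the new resolvent will be [E11 + kap E22], whose trace is
   [(1 + kap) / 2 = h (1 - c)]. *)
move=> hc; set kap := 2 * h * (1 - c) - 1; set c' := 2 * s * c * h / kap.
have h0' := h0; have h1' := h1; have c0' := c0; have s0' := s0.
have kap0 : 0 < kap by rewrite /kap; lra.
have c'0 : 0 <= c' by rewrite /c' divr_ge0 ?ltW // !mulr_gt0 //; lra.
have [t t01 ht] := rho_contr; have /andP[t0 t1] := t01.
pose r := rho (~~ i); pose D x := jj i (r x).
have lr : linear r := rho_linear (~~ i).
have lopr : lop r := rho_lop (~~ i).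
have lD : linear D by move=> a x y; rewrite /D lr jj_linear.
(* Here [S] is the inverse of [1 - J rho]. *)
have [|S [lS eS cS]] := neumann (t := t) lD _ (fun x => le_trans (jj_nm i (r x)) (ht _ x)).
  by rewrite ltW.
have le i' : alt i' i' (e i') by apply: alt_letter; constructor 1.
have hf' i' : alt i' i' (f i') by apply: alt_letter; constructor 2.
have lj i' : alt i' i' (jj i') by apply: alt_letter; constructor 3.
have ale : alt (~~ ~~ i) i (e i) by rewrite negbK.
have alj : alt (~~ ~~ i) i (jj i) by rewrite negbK.
have altg m : alt (~~ i) i (fun x => r (neu D m (e i x))).
  elim: m => [|m IH] /=.
    have := alt0 (~~ i) i; congr alt; apply: funext => x; by rewrite lin0.
  have := altD (alt_comp (rho_alt (~~ i)) ale)
               (alt_comp (alt_comp (rho_alt (~~ i)) alj) IH).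
  by congr alt; apply: funext => x; rewrite (linD lr).
have altA : alt i i (fun x => f i (r (S (e i x)))).
  apply: (alt_comp (hf' i)); apply: (alt_lim altg) => x.
  by apply: cv_lop => //; exact: cS.
(* The operator [wsum n.+1 i] vanishes on the range of [E11], where the resolvent is the identity;
   on the range of [E22] it is [kap] times [1] plus twice the alternating operator of [altA]. *)
have eta x : res (wsum n.+1 i) c' x =
    e i (f i x) + kap%:C *: (f i (e i x) + 2%:C *: f i (r (S (e i x)))).
  apply: (res_uniq hH (wbound_ge0 n.+1) (wsum_posop n.+1 i) c'0).
  set y := e i x; set v := S y.
  have rv : r v = jj i v - y.
    have := eS y; rewrite -/v /D => vE.
    have := congr1 (jj i) vE; rewrite (linD (jj_linear i)) jjK jje => ->.
    by rewrite addrC addKr.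
  have wE : v + r v = 2%:C *: e i (f i v) - y.
    rewrite rv; apply: (rip_inj hH) => z.
    by have := congr1 (rp^~ z) (effe i v); rewrite /jj /= !ripE; lra.
  have fw : f i (v + r v) = 2%:C *: f i v - f i y.
    by rewrite wE (linB (hf i)) (linZ (hf i)) fef.
  have fr : f i (r v) = f i v - f i y by rewrite rv (linB (hf i)) fjj.
  have kw := congr1 (f i) (wsum_res (~~ i) v).
  rewrite -/r (linZ (hf i)) (linB (hf i)) (linZ (hf i)) fw in kw.
  set F3 := f i (wsum _ _ _) in kw.
  have E1 : e i (f i x) + kap%:C *: (f i y + 2%:C *: f i (r v)) =
     e i (f i x) + kap%:C *: (2%:C *: f i v - f i y).
    by rewrite fr; apply: (rip_inj hH) => z; rewrite !ripE; lra.
  have E2 : e i (e i (f i x) + kap%:C *: (2%:C *: f i v - f i y)) = kap%:C *: (v + r v).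
    rewrite (linD (he i)) (linZ (he i)) (linB (he i)) (linZ (he i)) ee add0r wE.
    by rewrite /y efe.
  have [lk _ _] := wsum_posop n (~~ i).
  rewrite E1 [wsum n.+1 i _]/= E2 (linZ lk) -scalerDr (linZ (hf i)) (linD (hf i)) -/F3 fw.
  rewrite -[in RHS](effe i x) -/y.
  apply: (rip_inj hH) => z; have := congr1 (rp^~ z) kw; rewrite /= !ripE => kwz.
  have ck : c' * s^-1 * kap = 2 * c * h.
    by rewrite /c'; field; rewrite !gt_eqF.
  have hV : h * h^-1 = 1 by rewrite divff // gt_eqF //; lra.
  have kwh : h * (c * rp F3 z) = rp (f i v) z - h * (2 * rp (f i v) z - rp (f i y) z).
    by rewrite kwz mulrBr mulrA hV mul1r.
  set A := rp (f i v) z in kwh *; set B := rp (f i y) z in kwh *; set G := rp F3 z in kwh *.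
  have -> : c' * (s^-1 * (kap * (2 * A - B + G))) = 2 * c * h * (2 * A - B + G).
    by rewrite -ck; ring.
  rewrite /kap; lra.
have := altD (altZ ((1 - kap) / 2) (lj i)) (altZ (2 * kap) altA).
congr alt; apply: funext => x; rewrite eta /jj; apply: (rip_inj hH) => z.
have := congr1 (rp^~ z) (effe i x); rewrite /= !ripE /kap => <-.
lra.
Qed.

(* With [rho_i = R_i/h - 1], the operator [1/(1 + rho_0) + 1/(1 + rho_1) - 1] has
   inverse [(1 + rho_1) (1 - rho_0 rho_1)^-1 (1 + rho_0)]. *)
Lemma wtot_trace :
  rp (res (wtot n) (c * h / (2 * h - 1)) Omega) Omega = 2 * h - 1.
Proof.
(* These constants make [kap (1 + c' (wtot n))] equal to [1/(1 + rho_0) + 1/(1 + rho_1) - 1]. *)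
set kap := 2 * h - 1; set c' := c * h / kap.
have h0' := h0; have h1' := h1; have c0' := c0.
have kap0 : 0 < kap by rewrite /kap; lra.
have c'0 : 0 <= c' by rewrite /c' divr_ge0 ?ltW // !mulr_gt0 //; lra.
have [t t01 ht] := rho_contr; have /andP[t0 t1] := t01.
pose r := rho false; pose q := rho true; pose D x := r (q x).
have lr : linear r := rho_linear false; have lq : linear q := rho_linear true.
have lopq : lop q := rho_lop true.
have DE x : D x = r (q x) by [].
have lD : linear D by move=> a x y; rewrite /D lq lr.
have [||S [lS eS cS]] := neumann (t := t) lD.
- by rewrite ltW.
- move=> x; apply: le_trans (ht _ _) _; rewrite ler_pM2l //; apply: le_trans (ht _ _) _.
  by rewrite ler_piMl ?nm_ge0 // ltW.
have rA : alt false false r := rho_alt false; have qA : alt true true q := rho_alt true.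
(* The words are sorted by their last letter, [q] or [r], since [alt] fixes both end types. *)
have z m : exists A B, [/\ alt true true A, alt true false B &
    forall x, q (neu D m (x + r x)) = A x + B x].
  elim: m => [|m [A [B [hA hB zE]]]] /=.
    exists (fun=> 0), (fun=> 0); split=> [||x]; [exact: alt0|exact: alt0|].
    by rewrite lin0 // addr0.
  exists (fun x => q (r (A x)) + q x), (fun x => q (r (B x)) + q (r x)); split=> [||x].
  - by apply: altD => //; apply: (alt_comp qA); exact: (alt_comp rA).
  - by apply: altD; apply: (alt_comp qA) => //; exact: (alt_comp rA).
  - rewrite DE zE (linD lq) (linD lq) (linD lr) (linD lq).
    by rewrite addrACA [q x + _]addrC [q (r x) + _]addrC.
pose w x := S (x + r x) + q (S (x + r x)).
have eta x : res (wtot n) c' x = kap%:C *: w x.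
  apply: (res_uniq hH (wtot_bound_ge0 n) (wtot_posop n) c'0).
  set v := S (x + r x); set u := q v + x.
  have wu : w x = u + r u.
    have vE : v = x + r x + r (q v) := eS _.
    rewrite /w -/v /u (linD lr); apply: (rip_inj hH) => y.
    by have := congr1 (rp^~ y) vE; rewrite /= !ripE; lra.
  have k1 := wsum_res true v; rewrite -/q -[v + q v]/(w x) in k1.
  have k2 := wsum_res false u; rewrite -/r -wu in k2.
  have [l1 _ _] := wsum_posop n false; have [l2 _ _] := wsum_posop n true.
  rewrite /wtot (linZ l1) (linZ l2) -scalerDr; apply: (rip_inj hH) => y.
  rewrite /u in k2; have wE : w x = v + q v by [].
  move: (w x) (q v) wE k1 k2 => W Q wE k1 k2.
  have := congr1 (rp^~ y) k1; have := congr1 (rp^~ y) k2; have := congr1 (rp^~ y) wE.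
  rewrite /= !ripE.
  set A := rp (wsum _ _ _) y; set B := rp (wsum _ _ _) y => e0 e1 e2.
  have hV : h * h^-1 = 1 by rewrite divff // gt_eqF //; lra.
  have E1 : h * (c * A) = rp Q y + rp x y - h * rp W y.
    by rewrite e1 mulrBr mulrA hV mul1r.
  have E2 : h * (c * B) = rp v y - h * rp W y.
    by rewrite e2 mulrBr mulrA hV mul1r.
  have ck : c' * kap = c * h by rewrite /c' divfK // gt_eqF.
  by rewrite (mulrA c') ck /kap; lra.
rewrite eta ripZl -[RHS]mulr1; congr (_ * _); clear eta; clearbody r q.
have cw : cv (fun m => neu D m.+1 (Omega + r Omega) + q (neu D m.+1 (Omega + r Omega))) (w Omega).
  by apply: cvD; [|apply: cv_lop => //]; apply: (cvS (cS _)).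
(* Starting at [m.+1] skips the empty sum; every later partial sum is [1] plus alternating terms, so
   its trace is exactly [1]. *)
have trm m : rp (neu D m.+1 (Omega + r Omega) + q (neu D m.+1 (Omega + r Omega))) Omega = 1.
  have [A [B [hA hB zE]]] := z m; have [A' [B' [hA' hB' ->]]] := z m.+1.
  rewrite /= DE zE (linD lr) !ripE Omega1 (alt_trace0 rA) (alt_trace0 hA') (alt_trace0 hB').
  by rewrite (alt_trace0 (alt_comp rA hA)) (alt_trace0 (alt_comp rA hB)) !addr0.
apply/le_anti/andP; split.
  by apply: (cv_rip_le hH cw) => m; rewrite trm.
by apply: (cv_rip_ge hH cw) => m; rewrite trm.
Qed.

End Step.

(** * Traces of the resolvents *)

Definition hval n c : R := rp (res (wsum n false) c Omega) Omega.
Definition dval n c : R := rp (res (wtot n) c Omega) Omega.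

Lemma wtot_incr n x : rp (wtot n x) x <= rp (wtot n.+1 x) x.
Proof. by rewrite !ripDl lerD ?wsum_incr. Qed.

Lemma hval_le1 n c : 0 <= c -> hval n c <= 1.
Proof.
move=> c0; have [_ _ /(_ Omega)/andP[_]] := res_posop hH (wbound_ge0 n) (wsum_posop n false) c0.
by rewrite mul1r Omega1.
Qed.

Lemma hval_ge0 n c : 0 <= c -> 0 <= hval n c.
Proof.
by move=> c0; have [_ _ /(_ Omega)/andP[]] := res_posop hH (wbound_ge0 n) (wsum_posop n false) c0.
Qed.

Lemma hval_0 n : hval n 0 = 1.
Proof.
by rewrite /hval (res_uniq hH (wbound_ge0 n) (wsum_posop n false) (lexx 0) (x := Omega)) // rmorph0 scale0r addr0.
Qed.

Lemma res_wsum0 i c x : 0 <= c -> res (wsum 0 i) c x = x.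
Proof.
by move=> c0; rewrite (res_uniq hH (wbound_ge0 0) (wsum_posop 0 i) c0 (x := x)) // scaler0 addr0.
Qed.

Lemma hval_antitone n c c' : 0 <= c -> c <= c' -> hval n c' <= hval n c.
Proof.
move=> c0 cc'.
exact: (res_antitone hH _ (wbound_ge0 n) (wbound_ge0 n) (wsum_posop n false) (wsum_posop n false)).
Qed.

Lemma dval_antitone n c c' : 0 <= c -> c <= c' -> dval n c' <= dval n c.
Proof.
move=> c0 cc'.
exact: (res_antitone hH _ (wtot_bound_ge0 n) (wtot_bound_ge0 n) (wtot_posop n) (wtot_posop n)).
Qed.

(** The absolute values extend the function from [c >= 0] to the whole line, as the intermediate
    value theorem is applied to a continuous function on [R]. *)
Lemma hval_lipschitz n (x y : R) :
  `|hval n `|x| - hval n `|y| | <= wbound n * `|x - y|.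
Proof.
wlog xy : x y / `|x| <= `|y|.
  move=> W; have [/W //|/ltW/W] := leP `|x| `|y|.
  by rewrite (distrC y) (distrC (hval n `|y|)).
have h1 := hval_antitone n (normr_ge0 x) xy.
have h2 := res_lipschitz hH Omega (wbound_ge0 n) (wsum_posop n false) (normr_ge0 x) xy.
rewrite Omega1 mulr1 in h2; rewrite ger0_norm ?subr_ge0 //.
apply: le_trans h2 _; rewrite ler_wpM2l ?wbound_ge0 //.
by rewrite (distrC x) lerB_dist.
Qed.

Lemma hval_continuous n : continuous (fun x : R => hval n `|x|).
Proof.
move=> x; apply/cvgrPdist_le => eps eps0; have w0 := wbound_ge0 n.
near=> y; apply: le_trans (hval_lipschitz n x y) _.
have : `|x - y| <= eps / (wbound n + 1).
  near: y; apply: cvgr_dist_le; first exact: cvg_id.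
  by rewrite divr_gt0 // ltr_wpDl.
rewrite ler_pdivlMr ?ltr_wpDl // mulrC; apply: le_trans.
by rewrite ler_wpM2r // lerDl.
Unshelve. all: end_near.
Qed.

(** Every positive parameter is the image of another under the step map, so the recursion reaches
    all of them. The equation is solved with its denominator cleared, by the intermediate value
    theorem on [[0, 1]]. *)
Lemma step_surj n (c' : R) : 0 < c' -> exists c, [/\ 0 < c, 1 < 2 * hval n c * (1 - c) &
  c' = 2 * s * c * hval n c / (2 * hval n c * (1 - c) - 1)].
Proof.
move=> c'0; have s0' := s0.
pose F (x : R) : R := 2 * s * x * hval n `|x| - c' * (2 * hval n `|x| * (1 - x) - 1).
have cF : continuous F.
  have ch := @hval_continuous n.
  have cx : continuous (fun x : R => x) by move=> x; exact: cvg_id.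
  move=> x; apply: cvgB; apply: cvgM.
  - by apply: cvgM; [exact: cvg_cst | exact: cx].
  - exact: ch.
  - exact: cvg_cst.
  - apply: cvgB; last exact: cvg_cst.
    apply: cvgM; first by apply: cvgM; [exact: cvg_cst | exact: ch].
    by apply: cvgB; [exact: cvg_cst | exact: cx].
have F0 : F 0 = - c' by rewrite /F normr0 hval_0; ring.
have F1 : 0 <= F 1.
  rewrite /F normr1; have : 0 <= 2 * s * 1 * hval n 1 by rewrite !mulr_ge0 ?hval_ge0 // ltW.
  by lra.
have [||c] := @IVT R F 0 1 0 ler01.
- exact: continuous_subspaceT.
- by rewrite F0 ge_min le_max F1 oppr_le0 (ltW c'0) orbT.
rewrite in_itv /= => /andP[c0 c1] Fc.
have cp : 0 < c.
  rewrite lt0r c0 andbT; apply/eqP => cE; move: Fc; rewrite cE F0 => /eqP.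
  by rewrite oppr_eq0 gt_eqF.
rewrite /F ger0_norm // in Fc; exists c; set h := hval n c in Fc *.
have hp : 0 < h.
  have := res_lower hH (wbound_ge0 n) (wsum_posop n false) c0 Omega.
  rewrite Omega1 mulr1; apply: lt_le_trans; rewrite invr_gt0 exprn_gt0 //.
  by have := mulr_ge0 c0 (wbound_ge0 n); lra.
(* The cleared equation reads [c' * kap = 2 s c h] with positive right side, so the denominator
   [kap] is positive. *)
have kp : 0 < 2 * h * (1 - c) - 1.
  by rewrite -(pmulr_rgt0 _ c'0) -(subr0_eq Fc) !mulr_gt0.
split=> //; first lra.
by apply: (mulIf (lt0r_neq0 kp)); rewrite divfK ?gt_eqF // (subr0_eq Fc).
Qed.

(** Induction on [n] for all [c] at once: [step_surj] provides the preimage to which [wsum_step]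
    applies. Although [hval] is defined from the copy [false], it centers the resolvents of both
    copies. *)
Lemma hval_alt n c : 0 < c -> [/\ 1 / 2 < hval n c, hval n c <= 1 &
  forall i, alt i i (fun x => res (wsum n i) c x - (hval n c)%:C *: x)].
Proof.
elim: n c => [|n IH] c c0.
  have h1 : hval 0 c = 1 by rewrite /hval res_wsum0 ?ltW.
  rewrite h1; split=> [||i]; [lra | lra |].
  have := alt0 i i; congr alt; apply: funext => x.
  by rewrite res_wsum0 ?ltW // rmorph1 scale1r subrr.
have [c1 [c10 hc1 ->]] := step_surj n c0; have [h0 h1 hA] := IH _ c10.
have A i := wsum_step c10 h0 h1 hA i hc1.
set c2 := 2 * s * c1 * _ / _ in A *.
have E : hval n.+1 c2 = hval n c1 * (1 - c1).
  have := alt_trace0 (A false); rewrite !ripE Omega1 mulr1 => /subr0_eq.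
  by rewrite /hval.
split=> [||i]; rewrite E //; first lra.
have : hval n c1 * c1 >= 0 by rewrite mulr_ge0 // ?ltW //; lra.
lra.
Qed.

Lemma hval_step n c : 0 < c -> 1 < 2 * hval n c * (1 - c) ->
  hval n.+1 (2 * s * c * hval n c / (2 * hval n c * (1 - c) - 1)) = hval n c * (1 - c).
Proof.
move=> c0 hc; have [h0 h1 hA] := hval_alt n c0.
have := alt_trace0 (wsum_step c0 h0 h1 hA false hc).
by rewrite !ripE Omega1 mulr1 => /subr0_eq.
Qed.

Lemma dvalE n c : 0 < c -> dval n (c * hval n c / (2 * hval n c - 1)) = 2 * hval n c - 1.
Proof. by move=> c0; have [h0 h1 hA] := hval_alt n c0; exact: wtot_trace. Qed.

(** * Asymptotics of the traces *)

Hypothesis s2 : s < 1 / 2.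

(* [hstar] is the value of [h] at which the step map [c |-> c'] has slope [1] at
   [c = 0]. *)
Let hstar : R := 1 / (2 * (1 - s)).

Lemma hstarE : 2 * (1 - s) * hstar = 1.
Proof. by rewrite /hstar mulrC divfK // gt_eqF //; have := s2; lra. Qed.

(** The step map preserves the alternative: it raises the deficit [hstar - h] by [c h], and while
    the new deficit [x] is positive it multiplies [c h] by at least [1 + x]. *)
Lemma hval_lower n c : 0 < c ->
  hstar <= hval n c \/ (hstar - hval n c) ^+ 2 <= 2 * (c * hval n c).
Proof.
have hE := hstarE; have s2' := s2; have s0' := s0.
have hs1 : hstar <= 1 by nra.
elim: n c => [|n IH] c' c'0.
  left; have -> : hval 0 c' = 1 by rewrite /hval res_wsum0 ?ltW.
  exact: hs1.
have [c [c0 hc c'E]] := step_surj n c'0.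
have hS := hval_step c0 hc; rewrite -c'E in hS; rewrite hS.
have [h0 h1 _] := hval_alt n c0.
set h := hval n c in h0 h1 hc c'E *.
have [|lt] := leP hstar (h * (1 - c)); first by left.
right; set h' := h * (1 - c) in lt *; set x := hstar - h'.
have x0 : 0 < x by rewrite /x; lra.
have k0 : 0 < 2 * h' - 1 by rewrite /h'; lra.
have k1 : 2 * h' - 1 <= 1 by lra.
have ch0 : 0 < c * h by rewrite mulr_gt0 //; lra.
have hh : h - h' = c * h by rewrite /h'; ring.
have GE : (2 * h' - 1) * (c' * h') = 2 * s * (c * h) * h'.
  have kE : 2 * h * (1 - c) - 1 = 2 * h' - 1 by rewrite /h'; ring.
  by rewrite c'E -/h kE mulrA (mulrC (2 * h' - 1)) divfK ?gt_eqF //; ring.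
have key : c * h * (1 + x) <= c' * h'.
  rewrite -(ler_pM2l k0) GE.
  have -> : 2 * s * (c * h) * h' = c * h * (2 * s * h') by ring.
  rewrite mulrCA ler_pM2l //.
  (* Since [2 (1 - s) > 1 >= 2 h' - 1], this gives [2 s h' >= (2 h' - 1) (1 + x)]. *)
  have e1 : 2 * s * h' = 2 * h' - 1 + 2 * (1 - s) * x by rewrite /x; lra.
  rewrite e1; nra.
have [hh'|hh'] := IH _ c0; rewrite -/h in hh'.
  have xle : x <= c * h by rewrite /x; lra.
  by have := ler_wpM2r (ltW x0) xle; have := mulr_gt0 x0 x0; rewrite expr2; lra.
have xh : x - c * h = hstar - h by rewrite /x; lra.
rewrite -xh in hh'; set G := c * h in hh' key *; set K := c' * h' in key *.
by rewrite sqrrB in hh'; have := sqr_ge0 G; lra.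
Qed.

(** Otherwise the step always has [c' <= c], and monotonicity gives [h_(n+1) c <= h_n c (1 - c) <=
    h_n c - c / 2]; this linear decrease contradicts [h > 1 / 2]. *)
Lemma hval_upper c : 0 < c -> exists n, 2 * hval n c * (1 - s - c) <= 1.
Proof.
move=> c0; apply: contrapT => /forallNP H1; have s0' := s0.
have hs n : hval n.+1 c <= hval n c - c / 2.
  have [h0 h1 _] := hval_alt n c0; have /negP := H1 n; rewrite -ltNge => H2.
  have sh : 0 < s * hval n c by rewrite mulr_gt0 //; lra.
  have k0 : 0 < 2 * hval n c * (1 - c) - 1 by lra.
  have hS := hval_step c0 ltac:(lra).
  set c' := 2 * s * c * _ / _ in hS.
  have c'0 : 0 <= c' by rewrite /c' divr_ge0 ?(ltW k0) // !mulr_ge0 ?ltW //; lra.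
  have c'c : c' <= c.
    rewrite /c' ler_pdivrMr // (_ : 2 * s * c * hval n c = c * (2 * (s * hval n c))); last ring.
    rewrite ler_pM2l //.
    lra.
  have := hval_antitone n.+1 c'0 c'c; rewrite hS.
  have : c * (1 / 2) <= c * hval n c by rewrite ler_pM2l // ltW.
  lra.
have hn (n : nat) : hval n c <= 1 - n%:R * (c / 2).
  elim: n => [|n IH]; first by rewrite mul0r subr0 hval_le1 // ltW.
  apply: le_trans (hs n) _; rewrite -(natr1 n) mulrDl mul1r opprD addrA.
  by rewrite lerD2r.
pose N := (Num.truncn c^-1).+1; have [h0 _ _] := hval_alt N c0; have := hn N.
have : 1 < N%:R * c by rewrite -ltr_pdivrMr // div1r truncnS_gt.
move: (N%:R : R) (hval N c) h0 => m h; lra.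
Qed.

Lemma wsum_e n i x : wsum n i (e i x) = 0.
Proof.
case: n => [//|n] /=; have [lk _ _] := wsum_posop n (~~ i).
by rewrite ee (lin0 lk) addr0 lin0 // scaler0.
Qed.

(** Appending [e i] lengthens a word by one letter, which costs a factor [s] in the weight. *)
Lemma wtot_e n i x : rp (wtot n (e i x)) (e i x) <= s * rp (wtot n.+1 x) x.
Proof.
have -> : wtot n (e i x) = wsum n (~~ i) (e i x).
  by rewrite /wtot; case: i; rewrite wsum_e ?addr0 ?add0r.
have h1 := wsum_formS n i x; have h2 := rip_ge0 hH (e i x).
have h3 : rp (wsum n.+1 i x) x <= rp (wtot n.+1 x) x.
  rewrite /wtot ripDl; have [_ _ b1] := wsum_posop n.+1 false.
  have [_ _ b2] := wsum_posop n.+1 true; have /andP[c1 _] := b1 x; have /andP[c2 _] := b2 x.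
  by clear h1 h2; case: i; lra.
apply: le_trans (ler_wpM2l (ltW s0) h3); rewrite h1 mulrA divff ?gt_eqF // mul1r.
by rewrite lerDr.
Qed.

(** * The invariant projection *)

Definition dom x : Prop := exists M, forall n, rp (wtot n x) x <= M.

Lemma dom_e i x : dom x -> dom (e i x).
Proof.
move=> [M hM]; exists (s * M) => n; apply: le_trans (wtot_e n i x) _.
by rewrite ler_pM2l.
Qed.

Lemma invariant_projection : exists F, [/\ posop ip F 1, forall x, F (F x) = F x,
  forall i x, F (e i (F x)) = e i (F x),
  forall T, lop T -> (forall i x, T (e i x) = e i (T x)) ->
    (forall i x, T (f i x) = f i (T x)) -> forall x, T (F x) = F (T x) &
  rp (F Omega) Omega = s / (1 - s)].
Proof.
have s2' := s2; have s0' := s0; have hE := hstarE.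
have incr m n x : (m <= n)%N -> rp (wtot m x) x <= rp (wtot n x) x.
  by move/subnKC <-; elim: (n - m)%N => [|j IH]; rewrite ?addn0 // addnS (le_trans IH) // wtot_incr.
pose cc (j : nat) : R := j.+1%:R^-1.
have cc0 j : 0 < cc j by rewrite invr_gt0.
have ccS j : cc j.+1 <= cc j by rewrite lef_pV2 ?posrE // ler_nat.
have cce (eps : R) : 0 < eps -> exists j, cc j <= eps.
  move=> e0; exists (Num.truncn eps^-1); rewrite -[leRHS]invrK lef_pV2 ?posrE ?invr_gt0 //.
  by apply: ltW; exact: truncnS_gt.
have pr n j := res_posop hH (wtot_bound_ge0 n) (wtot_posop n) (ltW (cc0 j)).
have rdec n j x : rp (res (wtot n.+1) (cc j) x) x <= rp (res (wtot n) (cc j) x) x.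
  apply: (res_antitone hH _ (wtot_bound_ge0 n) (wtot_bound_ge0 n.+1) (wtot_posop n)
    (wtot_posop n.+1)) => //; [exact: ltW | exact: wtot_incr].
have exB j := decreasing_limit hH (fun n => pr n j) (fun n => rdec n j).
have [B hB] := choice exB.
have Ble j n x : rp (B j x) x <= rp (res (wtot n) (cc j) x) x.
  apply: (cv_rip_le hH (u := fun m => res (wtot (n + m)) (cc j) x)).
    move=> eps e0; have [n0 h] := (hB j).2 x eps e0; exists n0 => m mn; apply: h.
    by rewrite (leq_trans mn) // leq_addl.
  move=> m; elim: m => [|m IH]; rewrite ?addn0 // addnS.
  by apply: le_trans IH; exact: rdec.
have BleS j x : rp (B j x) x <= rp (B j.+1 x) x.
  apply: (cv_rip_ge hH ((hB j.+1).2 x)) => n; apply: le_trans (Ble j n x) _.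
  exact: (res_antitone hH _ (wtot_bound_ge0 n) (wtot_bound_ge0 n) (wtot_posop n)
    (wtot_posop n) (ltW (cc0 _)) (ccS j)).
have [F [pF cF]] := increasing_limit hH (fun j => (hB j).1) BleS.
have Fge j x : rp (B j x) x <= rp (F x) x.
  apply: (cv_rip_ge hH (u := fun m => B (j + m)%N x)).
    move=> eps e0; have [n0 h] := cF x eps e0; exists n0 => m mn; apply: h.
    by rewrite (leq_trans mn) // leq_addl.
  move=> m; elim: m => [|m IH]; rewrite ?addn0 // addnS.
  by apply: (le_trans IH); exact: BleS.
have lF : lop F := posop_lop hH ltr01 pF.
(* Lower semicontinuity: for fixed [m], positivity of the form at [yn - y] bounds [<yn, k y>] by the
   energy of [yn], and [yn] tends to [y]. The index [m + n] makes the energy bound apply to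
   [wtot m]. *)
have domB j x : dom (B j x).
  exists ((cc j)^-1 * rp x x) => m; set y := B j x.
  have [lk sk bk] := wtot_posop m.
  suff : rp y (wtot m y) <= (rp (wtot m y) y + (cc j)^-1 * rp x x) / 2.
    by rewrite (ripC ip y); lra.
  apply: (cv_rip_le hH (u := fun n => res (wtot (m + n)) (cc j) x)).
    move=> eps e0; have [n0 h] := (hB j).2 x eps e0; exists n0 => n mn; apply: h.
    by rewrite (leq_trans mn) // leq_addl.
  move=> n; set yn := res _ _ _.
  have := res_energy hH (wtot_bound_ge0 (m + n)) (wtot_posop (m + n)) (ltW (cc0 j)) x.
  rewrite -/yn mulrC -ler_pdivlMr // mulrC => en.
  have := le_trans (incr _ _ yn (leq_addr n m)) en.
  by have /andP[+ _] := bk (yn - y); rewrite sym_form_sub //; lra.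
have domF x : dom x -> F x = x.
  move=> [M hM]; have pG := posop_id_sub pF.
  have M0 : 0 <= M.
    by have [_ _ /(_ x)/andP[h _]] := wtot_posop 0; exact: le_trans h (hM 0%N).
  suff h : rp (x - F x) x <= 0.
    apply/esym/subr0_eq/(rip0_eq0 hH); have := pos_cs x ltr01 pG.
    by have := rip_ge0 hH (x - F x); lra.
  apply/ler_addgt0Pl => eps e0; rewrite addr0.
  (* By [res_defect], [<x - B j x, x>] is at most [cc j * M], which is made smaller than [eps]. *)
  have [j hj] := cce (eps / (M + 1)) ltac:(by rewrite divr_gt0 // ltr_wpDl).
  rewrite ler_pdivlMr ?ltr_wpDl // in hj.
  have : rp x x - cc j * M <= rp (B j x) x.
    apply: (cv_rip_ge hH ((hB j).2 x)) => n.
    have := res_defect hH (wtot_bound_ge0 n) (wtot_posop n) (ltW (cc0 j)) x.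
    have : cc j * rp (wtot n x) x <= cc j * M by rewrite ler_pM2l.
    by rewrite !ripE; lra.
  by have := Fge j x; have := cc0 j; rewrite !ripE; lra.
exists F; split=> //.
- move=> x; apply: (cv_uniq (cv_lop lF (cF x))).
  (* The vectors [B n x] lie in [dom], where [F] is the identity, and they converge to [F x]. *)
  by have -> : (fun n => F (B n x)) = (fun n => B n x) by apply: funext => n; exact: domF.
- move=> i x; have lei : lop (e i) by apply: (@letter_lop i); constructor 1.
  apply: (cv_uniq (cv_lop (lop_comp lF lei) (cF x))).
  have -> : (fun n => (F \o e i) (B n x)) = (fun n => e i (B n x)).
    by apply: funext => n; apply: domF; exact: dom_e.
  exact: cv_lop.
- move=> T lT Te Tf x.
  have Tw n i y : wsum n i (T y) = T (wsum n i y).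
    elim: n i y => [|n IH] i y /=; first by rewrite (lin0 lT.1).
    by rewrite -Te IH -(linD lT.1) -Tf (linZ lT.1).
  have Tr n j y : res (wtot n) (cc j) (T y) = T (res (wtot n) (cc j) y).
    apply: (res_comm hH (wtot_bound_ge0 n) (wtot_posop n) (ltW (cc0 j)) lT.1) => z.
    by rewrite /wtot !Tw (linD lT.1).
  have TB j y : B j (T y) = T (B j y).
    apply: (cv_uniq ((hB j).2 (T y))).
    have -> : (fun n => res (wtot n) (cc j) (T y)) = (fun n => T (res (wtot n) (cc j) y)).
      by apply: funext => n.
    by apply: cv_lop lT _; exact: (hB j).2.
  apply: (cv_uniq (cv_lop lT (cF x))).
  have -> : (fun n => T (B n x)) = (fun n => B n (T x)) by apply: funext => n.
  exact: cF.
have dE : s / (1 - s) = 2 * hstar - 1.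
  have : 1 - s != 0 by rewrite gt_eqF //; lra.
  move=> s1; apply: (mulIf s1); rewrite divfK //; lra.
have d0 : 0 < 2 * hstar - 1 by rewrite -dE divr_gt0 //; lra.
have lower (eps c : R) n : 0 < eps -> 0 < c -> 2 * c <= eps ^+ 2 -> hstar - eps <= hval n c.
  move=> e0 c0 ce; have [h0 h1 _] := hval_alt n c0.
  have [|h] := hval_lower n c0; first by lra.
  rewrite leNgt; apply/negP => lt.
  have : eps ^+ 2 < (hstar - hval n c) ^+ 2 by rewrite ltr_pXn2r // ?nnegrE; lra.
  have : c * hval n c <= c by rewrite ler_piMr // ltW.
  lra.
rewrite dE; apply/le_anti/andP; split.
  apply: (cv_rip_le hH (cF Omega)) => j; rewrite leNgt; apply/negP.
  set b := rp _ _ => lt.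
  (* Half of the slack: [(1 + b) (1 - s - eta)] still exceeds [1]. *)
  pose eta := ((1 + b) * (1 - s) - 1) / (2 * (1 + b)).
  have b1 : 1 < (1 + b) * (1 - s).
    have : (2 * hstar) * (1 - s) < (1 + b) * (1 - s) by rewrite ltr_pM2r; lra.
    lra.
  have eta0 : 0 < eta by rewrite /eta divr_gt0 //; lra.
  have etaE : (1 + b) * eta = ((1 + b) * (1 - s) - 1) / 2.
    by rewrite /eta; field; rewrite !gt_eqF //; lra.
  (* The first bound preserves the slack, the third gives [2 h - 1 >= (2 hstar - 1) / 2] through
     [lower], and with it the second gives [c h / (2 h - 1) <= cc j]. Then [1 + b <= 2 h]
     contradicts [hval_upper]. *)
  pose c := Num.min eta (Num.min (cc j * ((2 * hstar - 1) / 2)) (((2 * hstar - 1) / 4) ^+ 2 / 2)).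
  have c1 : c <= eta by rewrite ge_min lexx.
  have c2 : c <= cc j * ((2 * hstar - 1) / 2) by rewrite !ge_min lexx orbT.
  have c3 : c <= ((2 * hstar - 1) / 4) ^+ 2 / 2 by rewrite !ge_min lexx !orbT.
  have c0 : 0 < c.
    rewrite !lt_min eta0 /=; apply/andP; split; first by rewrite mulr_gt0 // divr_gt0.
    by rewrite divr_gt0 // exprn_gt0 // divr_gt0.
  have [n hn] := hval_upper c0; have [h0 h1 _] := hval_alt n c0.
  have hl := lower ((2 * hstar - 1) / 4) c n ltac:(lra) c0 ltac:(lra).
  have b2 : 1 + b <= 2 * hval n c.
    suff : b <= dval n (c * hval n c / (2 * hval n c - 1)) by rewrite dvalE //; lra.
    apply: le_trans (Ble j n Omega) _; apply: dval_antitone.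
      by rewrite divr_ge0 ?mulr_ge0 ?ltW //; lra.
    rewrite ler_pdivrMr; last lra.
    have : c * hval n c <= c by rewrite ler_piMr // ltW.
    have : cc j * ((2 * hstar - 1) / 2) <= cc j * (2 * hval n c - 1).
      by rewrite ler_pM2l //; lra.
    lra.
  have : (1 + b) * c <= (1 + b) * eta by rewrite ler_pM2l //; lra.
  have p0 : 0 < 1 - s - c.
    have : 0 < (1 + b) * (1 - s - eta) by lra.
    by rewrite pmulr_rgt0; lra.
  have : (1 + b) * (1 - s - c) <= 2 * hval n c * (1 - s - c) by rewrite ler_pM2r.
  lra.
apply/ler_addgt0Pl => eps e0.
have e2 : 0 < eps / 2 by lra.
have [j hj] := cce ((eps / 2) ^+ 2 / 2) ltac:(by rewrite divr_gt0 // exprn_gt0).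
suff : 2 * hstar - 1 - eps <= rp (B j Omega) Omega by have := Fge j Omega; lra.
apply: (cv_rip_ge hH ((hB j).2 Omega)) => n; rewrite -/(dval n (cc j)).
have [h0 h1 _] := hval_alt n (cc0 j).
have hl := lower _ _ n e2 (cc0 j) ltac:(lra).
suff : 2 * hval n (cc j) - 1 <= dval n (cc j) by lra.
(* As [h <= 1], the factor [h / (2 h - 1)] is at least [1], so the parameter in [dvalE] is at least
   [cc j]. *)
rewrite -{1}(dvalE n (cc0 j)); apply: dval_antitone; first exact: ltW.
rewrite ler_pdivlMr; last lra.
by rewrite ler_pM2l //; lra.
Qed.

End FreeMatrixUnits.

(** * The free product *)

Section FreeProduct.
Variables (R : realType) (H : completeNormedModType R[i]).
Variable ip : {dot H for @conjC R[i]}.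
Hypothesis hH : is_hilbert ip.
Local Notation rp := (rip ip).
Implicit Types (x y z : H) (T S F : H -> H).

Lemma bounded_ops_lop T : bounded_ops T -> lop T.
Proof.
move=> [lT cT]; split=> //.
have /cvgrPdist_le/(_ 1 ltr01)/nbhs_ballP[d /= d0 hd] := cT 0.
have dE : d = (complex.Re d)%:C by rewrite RRe_real // gtr0_real.
move: d0 hd; rewrite dE ltcR; move: (complex.Re d) => {dE}d d0 hd.
exists (2 / d) => x; have [->|x0] := eqVneq x 0.
  by rewrite (lin0 lT) nm0 mulr0.
have nx : 0 < nm x.
  by rewrite lt0r nm_ge0 andbT; apply: contra_neq x0; exact: nm0_eq0.
(* Rescaling [x] to norm [d / 2] places it inside the ball given by continuity at [0]. *)
pose b := d / 2 / nm x; have b0 : 0 < b by rewrite !divr_gt0.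
have : nm (T (b%:C *: x)) <= 1.
  rewrite -lecR rmorph1 -normE; have := hd (b%:C *: x).
  rewrite -ball_normE /ball_ /= sub0r normrN (normE (b%:C *: x)) nmZ (ger0_norm (ltW b0)).
  by rewrite divfK ?gt_eqF // ltcR (lin0 lT) sub0r normrN; apply; lra.
rewrite (linZ lT) nmZ (ger0_norm (ltW b0)) mulrC -ler_pdivlMr // => /le_trans; apply.
rewrite (_ : 1 / b = 2 / d * nm x) // /b; field.
by rewrite !gt_eqF.
Qed.

Lemma lopZ (a : R[i]) T : lop T -> lop (fun x => a *: T x).
Proof.
move=> lT; have [C C0 hC] := lop_bound lT; split=> [b x y|].
  by rewrite lT.1 scalerDr !scalerA mulrC.
have aE : `|a| = (complex.Re `|a|)%:C by rewrite RRe_real // ger0_real.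
exists (complex.Re `|a| * C) => x; rewrite -lecR -normE normrZ aE normE -rmorphM lecR -mulrA.
by rewrite ler_wpM2l // -ler0c -aE.
Qed.

Lemma lopD T S : lop T -> lop S -> lop (fun x => T x + S x).
Proof.
move=> lT lS; have := lop_lin 1 lT lS; congr lop; apply: funext => x.
by rewrite rmorph1 scale1r.
Qed.

(** Bounded operators leaving the range of [F] invariant form a subalgebra, so checking the
    generators suffices. *)
Lemma Lat_algebra F (A : set (H -> H)) T :
  bounded_ops F -> A `<=` @bounded_ops R H -> (forall S, A S -> F \o S \o F = S \o F) ->
  algebra_generated A T -> bounded_ops T /\ F \o T \o F = T \o F.
Proof.
move=> bF bA hA /(_ [set S | bounded_ops S /\ F \o S \o F = S \o F]); apply.
split; last by move=> S AS; split; [exact: bA | exact: hA].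
have lF := bF.1.
split.
- by move=> S [].
- split; last by apply: funext => x /=; rewrite (lin0 lF).
  by apply: lop_bounded_ops; split=> [a x y|]; [rewrite scaler0 addr0 | exists 0 => x; rewrite nm0 mul0r].
- move=> S T' [/bounded_ops_lop lS hS] [/bounded_ops_lop lT hT]; split.
    exact/lop_bounded_ops/lopD.
  apply: funext => x /=; rewrite (linD lF).
  by congr (_ + _); [have := congr1 (@^~ x) hS | have := congr1 (@^~ x) hT].
- move=> c S [/bounded_ops_lop lS hS]; split; first exact/lop_bounded_ops/lopZ.
  by apply: funext => x /=; rewrite (linZ lF); congr (_ *: _); have := congr1 (@^~ x) hS.
- move=> S T' [/bounded_ops_lop lS hS] [/bounded_ops_lop lT hT]; split.
    exact/lop_bounded_ops/lop_comp.
  apply: funext => x /=.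
  have h2 : F (T' (F x)) = T' (F x) by have := congr1 (@^~ x) hT.
  by rewrite -h2; have := congr1 (@^~ (T' (F x))) hS.
Qed.

Variables (phi psi : 'M[R[i]]_2 -> H -> H) (Omega : H).
Hypothesis hM : free_product_M2 ip phi psi Omega.

Let pi (i : bool) := if i then psi else phi.
Let tau := vector_state ip Omega.

Lemma pi_copy i : matrix_copy ip tau (pi i).
Proof. by have [[h1 h2] _ _ _ _] := hM; case: i. Qed.

Let e i := pi i (delta_mx 0 1).
Let f i := pi i (delta_mx 1 0).

Lemma piD i a b x : pi i (a + b) x = pi i a x + pi i b x.
Proof.
have [_ h _ _ _] := pi_copy i; have := h 1 a b.
by rewrite scale1r => ->; rewrite scale1r.
Qed.
Lemma pi0 i x : pi i 0 x = 0.
Proof. by have := piD i 0 0 x; rewrite addr0 => /eqP; rewrite -subr_eq subrr => /eqP. Qed.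
Lemma piM i a b x : pi i a (pi i b x) = pi i (a *m b) x.
Proof. by have [_ _ [_ ->] _ _] := pi_copy i. Qed.
Lemma piN i a x : pi i (- a) x = - pi i a x.
Proof. by apply/eqP; rewrite -addr_eq0 -piD addNr pi0. Qed.
Lemma pi1 i x : pi i 1%:M x = x.
Proof. by have [_ _ [-> _] _ _] := pi_copy i. Qed.

Lemma e_linear i : linear (e i).
Proof. by have [/(_ (delta_mx 0 1))[]] := pi_copy i. Qed.
Lemma f_linear i : linear (f i).
Proof. by have [/(_ (delta_mx 1 0))[]] := pi_copy i. Qed.

Lemma ef_adj i x y : rp (e i x) y = rp x (f i y).
Proof.
have [_ _ _ /(_ (delta_mx 0 1)) h _] := pi_copy i; rewrite (adj_rip h); congr (rp _ (pi i _ _)).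
by apply/matrixP => a b; rewrite !mxE rmorph_nat andbC.
Qed.

Lemma e_e i x : e i (e i x) = 0.
Proof. by rewrite /e piM mul_delta_mx_0 // pi0. Qed.
Lemma f_f i x : f i (f i x) = 0.
Proof. by rewrite /f piM mul_delta_mx_0 // pi0. Qed.

Lemma ef_fe i x : e i (f i x) + f i (e i x) = x.
Proof.
rewrite /e /f !piM !mul_delta_mx -piD -[RHS](pi1 i); congr (pi i _ _).
by apply/matrixP => a b; rewrite !mxE; case: a b => [[|[|[]]]//= ?] [[|[|[]]]//= ?]; rewrite ?addr0 ?add0r.
Qed.

Lemma Omega_unit : ip Omega Omega = 1.
Proof.
have [_ _ [h _] _ ht] := pi_copy false; have := ht 1%:M.
by rewrite h /tau /vector_state mxtrace1 mulVf // pnatr_eq0.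
Qed.

Lemma letter_centered i T : letter e f i T ->
  (if i then range psi else range phi) T /\ tau T = 0.
Proof.
suff : letter e f i T -> exists2 a, T = pi i a & \tr a = 0.
  move=> h /h[a -> ta]; have [_ _ _ _ ht] := pi_copy i.
  by rewrite ht ta mulr0; split=> //; rewrite /pi; case: ifP => _; exists a.
case=> ->.
- by exists (delta_mx 0 1) => //; rewrite /mxtrace big1 // => a _; rewrite mxE; case: a => [[|[|[]]]].
- by exists (delta_mx 1 0) => //; rewrite /mxtrace big1 // => a _; rewrite mxE; case: a => [[|[|[]]]].
- exists (delta_mx 0 0 - delta_mx 1 1).
    by apply: funext => x; rewrite /jj /e /f !piM !mul_delta_mx piD piN.
  by rewrite raddfB /= /mxtrace !big_ord_recl !big_ord0 !mxE /= !addr0 add0r subrr.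
Qed.

(** An inductive word is turned into an indexed product as in [free_pair]; the condition [k 0%N = i]
    is carried along so that a prepended letter alternates with the next. *)
Lemma word_trace0 i j W : word e f i j W -> rp (W Omega) Omega = 0.
Proof.
have [_ hfree _ _ _] := hM.
suff : word e f i j W -> exists (n : nat) (k : nat -> bool) (T : nat -> H -> H),
    [/\ k 0%N = i, forall m, (m <= n)%N -> (if k m then range psi else range phi) (T m) /\ tau (T m) = 0,
      forall m, (m < n)%N -> k m != k m.+1 &
      W = \big[(fun S S' => S \o S')/id]_(0 <= m < n.+1) T m].
  move=> h /h[n [k [T [_ h1 h2 ->]]]].
  by have := hfree n k T h1 h2; rewrite /vector_state /rip => ->.
elim=> {i j W} [i T hT | i j T W hT _ [n [k [U [k0 h1 h2 ->]]]]].
  exists 0%N, (fun=> i), (fun=> T); split=> // [m _|]; first exact: letter_centered.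
  by rewrite big_ltn // big_geq.
exists n.+1, (fun m => if m is m'.+1 then k m' else i), (fun m => if m is m'.+1 then U m' else T).
split=> // [[|m]|[|m]|].
- by move=> _; exact: letter_centered.
- exact: h1.
- by rewrite k0; case: (i).
- exact: h2.
- by rewrite [RHS]big_ltn // big_add1 /=.
Qed.

(** Operators commuting with both copies commute with [F], so [F] is in the double commutant; hence
    [F] commutes with the commutant of the algebra, whose elements preserve its range. *)
Lemma projection_of_spec F (r : R) : lop F -> sym ip F -> (forall x, F (F x) = F x) ->
  (forall i x, F (e i (F x)) = e i (F x)) ->
  (forall T, lop T -> (forall i x, T (e i x) = e i (T x)) ->
    (forall i x, T (f i x) = f i (T x)) -> forall x, T (F x) = F (T x)) ->
  rp (F Omega) Omega = r ->
  [/\ projection ip F, vN_of_copies ip phi psi F, vector_state ip Omega F = r%:C &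
      in_Lat ip F (algebra_A4 ip phi psi)].
Proof.
move=> lF sF FF Fe FT tF; have bF := lop_bounded_ops lF.
have aF : adjoint ip F F := sym_adjoint lF.1 sF.
have pF : projection ip F by split=> //; apply: funext.
have vF : vN_of_copies ip phi psi F.
  split=> // S [/bounded_ops_lop lS hS].
  have Spi i a y : S (pi i a y) = pi i a (S y).
    suff h : pi i a \o S = S \o pi i a by have := congr1 (@^~ y) h.
    by apply: hS; left; rewrite /pi; case: i; [right|left]; exists a.
  by apply: funext => x; apply: FT => // i y; exact: Spi.
split=> //.
  have := aF Omega Omega; rewrite [in X in _ = X -> _]ipC /vector_state conjCE -tF /rip.
  case: (ip (F Omega) Omega) => a b /= [ ] bE; congr (Complex _ _); lra.
split=> // T /Lat_algebra-/(_ _ bF) [] //.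
- move=> S [[->|->]|[]//].
    by have [h _ _ _ _] := pi_copy false; exact: h.
  by have [h _ _ _ _] := pi_copy true; exact: h.
- move=> S [[->|->]|[_ hS]]; apply: funext => x /=; [exact: (Fe false)|exact: (Fe true)|].
  by have := congr1 (@^~ (F x)) (hS F vF) => /= ->; rewrite FF.
Qed.

Lemma projection_of_trace (r : R) : 0 <= r <= 1 -> exists F,
  [/\ projection ip F, vN_of_copies ip phi psi F, vector_state ip Omega F = r%:C &
      in_Lat ip F (algebra_A4 ip phi psi)].
Proof.
move=> /andP[r0 r1]; have O1 : rp Omega Omega = 1 by rewrite /rip Omega_unit.
have [->|rn0] := eqVneq r 0.
  exists (fun=> 0); apply: projection_of_spec => //.
  - by split=> [a x y|]; [rewrite scaler0 addr0 | exists 0 => x; rewrite nm0 mul0r].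
  - by move=> x y; rewrite !ripE.
  - by move=> i x; rewrite (lin0 (e_linear i)).
  - by move=> T [lT _] _ _ x; rewrite lin0.
  - by rewrite rip0l.
have [->|rn1] := eqVneq r 1.
  by exists id; apply: projection_of_spec => //; exact: lop_id.
have rp0 : 0 < r by rewrite lt0r rn0.
have rp1 : r < 1 by rewrite lt_neqAle rn1.
(* The value [s = r / (1 + r)] solves [s / (1 - s) = r], and [r < 1] means [s < 1 / 2]. *)
have s0 : 0 < r / (1 + r) by rewrite divr_gt0 //; lra.
have s2 : r / (1 + r) < 1 / 2 by rewrite ltr_pdivrMr; lra.
have [F [pF FF Fe FT tF]] := invariant_projection hH e_linear f_linear ef_adj e_e f_f ef_fe O1
  word_trace0 s0 s2.
exists F; apply: projection_of_spec => //; first exact: (posop_lop hH ltr01 pF).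
  by case: pF.
by rewrite tF; field; rewrite !gt_eqF //; lra.
Qed.

Lemma not_transitive : ~ transitive_algebra (algebra_A4 ip phi psi).
Proof.
move=> [_ _ tr]; have [F [[bF FF aF] _ tF [_ LF]]] := @projection_of_trace (1 / 2) ltac:(lra).
have [lF cF] := bF.
(* The range of [F] is its fixed space, closed as the kernel of [1 - F]; the trace [1 / 2] keeps it
   from being [0] or everything. *)
pose F' x := (-1) *: F x + x.
have lF' : lop F' by apply: lopD (@lop_id _ _); exact/lopZ/bounded_ops_lop.
pose K := [set x | F x = x].
have FK x : K (F x) by have := congr1 (@^~ x) FF.
have [||K0|KT] := tr K.
- split=> [||c x y]; rewrite /K /=; [|exact: lin0|by rewrite lF => -> ->].
  rewrite (_ : [set x | F x = x] = F' @^-1` [set 0]).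
    apply: preimage_closed => [x _|]; first by have [_] := lop_bounded_ops lF'; apply.
    exact/accessible_closed_set1/hausdorff_accessible/norm_hausdorff.
  apply/seteqP; split=> x; rewrite /F' /= scaleN1r; first by move=> ->; rewrite addrC subrr.
  by move/eqP; rewrite addrC subr_eq0 => /eqP /esym.
- move=> T AT _ [x Kx <-]; have := congr1 (@^~ x) (LF T AT).
  by rewrite /= Kx.
- have F0 x : F x = 0 by have := FK x; rewrite K0.
  by move: tF; rewrite /vector_state F0 linear0l => [[]] /eqP; rewrite eq_sym => /eqP; lra.
- have F1 x : F x = x by have : K x by rewrite KT.
  by move: tF; rewrite /vector_state F1 Omega_unit => [[]]; lra.
Qed.

End FreeProduct.

Theorem theorem5p15 (R : realType) (H : completeNormedModType R[i])
    (ip : {dot H for @conjC R[i]}) (phi psi : 'M[R[i]]_2 -> H -> H) (Omega : H)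
    (hH : is_hilbert ip) (hM : free_product_M2 ip phi psi Omega) :
  ~ transitive_algebra (algebra_A4 ip phi psi) /\
  (forall r : R, 0 <= r <= 1 ->
     exists F : H -> H,
       [/\ projection ip F,
           vN_of_copies ip phi psi F,
           vector_state ip Omega F = r%:C &
           in_Lat ip F (algebra_A4 ip phi psi)]).
Proof.
by split; [exact: not_transitive hM | exact: projection_of_trace].
Qed.
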